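(* Let $W$ be a random variable with $\mathbb P(W>0)=1$, $\mathbb E[W]=1$ and $\mathbb E[W\log_2 W]<1$, let $\rho$ be the random cascade metric on $[0,1]$ built from $W$ (see context), and let $\phi(s):=s-\log_2\mathbb E[W^s]$. Let $K\subset[0,1]$ be a deterministic nonempty set, $\zeta_0$ its Hausdorff dimension with respect to the Euclidean metric, and $\zeta$ its Hausdorff dimension with respect to $\rho$. Then almost surely $\phi(\zeta)\le\zeta_0$.
   Context: For $n\ge 0$ let $\mathcal I_n$ be the set of dyadic intervals $[k2^{-n},(k+1)2^{-n}]$, $k\in\{0,\dots,2^n-1\}$, and $\mathcal I=\bigcup_n\mathcal I_n$. Let $(W_I)_{I\in\mathcal I}$ be i.i.d. copies of $W$. For $x\in[0,1]$ let $I_j(x)$ be the interval of $\mathcal I_j$ containing $x$ (if there are two, the one whose maximum is $x$). Let $\mu_0$ be Lebesgue measure on $[0,1]$ and $\mu_n:=w_n\,\mu_0$ where $w_n(x):=\prod_{j=0}^{n-1}W_{I_j(x)}$. The weak limit $\mu:=\lim_{n\to\infty}\mu_n$ exists almost surely. The random metric is $\rho(x,y):=\mu[x,y]$ for $0\le x\le y\le 1$ (and symmetrically). *)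

(* Defs.v *)
From HB Require Import structures.
From mathcomp Require Import all_boot all_order all_algebra.
From mathcomp Require Import all_classical all_reals all_analysis.
Set Implicit Arguments. Unset Strict Implicit. Unset Printing Implicit Defensive.
Import Order.TTheory GRing.Theory Num.Theory.
Import numFieldNormedType.Exports.
Local Open Scope classical_set_scope.
Local Open Scope ring_scope.

Section Defs.
Variable R : realType.

Definition log2 (x : R) : R := ln x / ln 2.
Definition elog2 (x : \bar R) : \bar R :=
  match x with
  | r%:E => (log2 r)%:E
  | +oo%E => +oo%E
  | -oo%E => -oo%E
  end.

(** Dyadic intervals: the interval of level n with index k is
    [k 2^-n, (k+1) 2^-n], for k < 2^n. *)
Definition dyadic_index (nk : nat * nat) : bool := (nk.2 < 2 ^ nk.1)%N.

(** I_j(x): index k of the interval of level j containing x in [0,1];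
    when there are two, the one whose maximum is x.  Explicitly
    k = ceil(x 2^j) - 1 for x > 0, and k = 0 for x = 0. *)
Definition dyidx (j : nat) (x : R) : nat :=
  if x <= 0 then 0%N else `|Num.ceil (x * 2 ^+ j) - 1|%N.

Definition euclid (x y : R) : \bar R := (`|x - y|)%:E.

(** diameter of U for a \bar R-valued distance d (0 for the empty set) *)
Definition diam (d : R -> R -> \bar R) (U : set R) : \bar R :=
  ereal_sup ([set 0%E] `|` [set d x y | x in U & y in U]).

Definition hcontent (A : set R) (d : R -> R -> \bar R) (s delta : R)
    (K : set R) : \bar R :=
  ereal_inf [set (\sum_(0 <= i <oo) (diam d (F i)) `^ s)%E |
             F in [set F : nat -> set R |
                   K `<=` \bigcup_i F i /\
                   forall i, F i `<=` A /\ (diam d (F i) <= delta%:E)%E]].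

Definition hmeasure (A : set R) (d : R -> R -> \bar R) (s : R) (K : set R)
  : \bar R :=
  ereal_sup [set hcontent A d s delta K | delta in [set delta : R | 0 < delta]].

Definition hdim (A : set R) (d : R -> R -> \bar R) (K : set R) : \bar R :=
  ereal_inf [set s%:E | s in [set s : R | 0 < s /\ hmeasure A d s K = 0%E]].

End Defs.

Section Prob.
Context {d : measure_display} {T : measurableType d} {R : realType}.
Variable P : probability T R.

Definition mutually_independent {I : eqType} (idx : I -> bool)
    (X : I -> T -> R) : Prop :=
  forall (s : seq I) (B : I -> set R),
    uniq s -> all idx s -> (forall i, measurable (B i)) ->
    P (\big[setI/setT]_(i <- s) (X i @^-1` B i)) =
    (\prod_(i <- s) P (X i @^-1` B i))%E.

Definition same_law (X Y : T -> R) : Prop :=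
  forall B : set R, measurable B -> P (X @^-1` B) = P (Y @^-1` B).

Definition cascade_weight (W : nat * nat -> T -> R) (n : nat) (om : T) (x : R)
  : R := \prod_(j < n) W (j : nat, dyidx j x) om.

Definition cascade_phi (X : T -> R) (s : R) : \bar R :=
  (s%:E - elog2 (\int[P]_om ((X om) `^ s)%:E))%E.

Definition cascade_metric (mu : {measure set R -> \bar R}) (x y : R) : \bar R :=
  if x <= y then mu `[x, y]%classic else mu `[y, x]%classic.

Definition weak_limit_cascade (W : nat * nat -> T -> R) (om : T)
    (mu : {measure set R -> \bar R}) : Prop :=
  (mu `[0%R, 1%R]%classic < +oo)%E /\
  forall f : R -> R, continuous f ->
    (fun n => (\int[lebesgue_measure]_(x in `[0%R, 1%R])
                 (f x * cascade_weight W n om x)%:E)%E)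
      @ \oo --> (\int[mu]_(x in `[0%R, 1%R]) (f x)%:E)%E.

End Prob.

(* Main.v *)
Require Import Defs.
From HB Require Import structures.
From mathcomp Require Import all_boot all_order all_algebra.
From mathcomp Require Import all_classical all_reals all_analysis.
From mathcomp Require Import measurable_realfun ring lra zify.
Set Implicit Arguments. Unset Strict Implicit. Unset Printing Implicit Defensive.
Import Order.TTheory GRing.Theory Num.Theory.
Import numFieldNormedType.Exports.
Local Open Scope classical_set_scope.
Local Open Scope ring_scope.

(** A first moment argument.  For a dyadic interval [I] of level [m] and
    [0 < s <= 1], independence along the path to [I] and [y^s <= s y + 1 - s]
    give [E[mu_n(I)^s] <= (2^-s E[W^s])^m = |I|^phi(s)] for all [n >= m]; by
    Fatou's lemma the same bound, up to a constant, holds for [mu] of a ball of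
    radius [2^-m].  If [K] has Euclidean covers with [sum |I_i|^t] arbitrarily
    small and [t <= phi(s)], the expected value of [sum mu(I_i)^s] along these
    covers is arbitrarily small, so the [s]-dimensional measure of [K] for [rho]
    vanishes almost surely.  Since [phi(s) >= (s / zeta) phi(zeta)] for
    [s <= zeta], having [phi(zeta) > zeta_0] would allow some rational
    [s < zeta], a contradiction.

    That [zeta <= 1] requires [mu] to have no atoms.  The largest mass [M_m] of
    an interval of level [m] satisfies [M_(m+1) = (W / 2) max(M', M'')] with
    [M', M''] independent copies of [M_m], hence
    [E M_(m+1) = E M_m - E min(M', M'') / 2 <= E M_m - (t / 2) P(M_m > t)^2].
    Telescoping, [sum_m P(M_m > t)^2 <= 2 / t]. *)

(** * Laws of families of random variables *)

Section cylinders.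
Context {R : realType} {I : eqType}.

Definition cylinder (s : seq I) (B : I -> set R) : set (I -> R) :=
  [set w | forall i, i \in s -> B i (w i)].

Definition cylinders : set (set (I -> R)) :=
  [set A | exists (s : seq I) (B : I -> set R),
     [/\ uniq s, forall i, measurable (B i) & A = cylinder s B]].

Lemma cylinders_setI : setI_closed cylinders.
Proof.
move=> _ _ [s [B [us mB ->]]] [t [C [ut mC ->]]].
exists (undup (s ++ t)), (fun i =>
  (if i \in s then B i else setT) `&` (if i \in t then C i else setT)).
split; first exact: undup_uniq.
  by move=> i; apply: measurableI; case: ifP => _.
apply/seteqP; split => [w [/= ws wt] i|w /= wst].
  by rewrite mem_undup => _; split; case: ifP => // it; [exact: ws|exact: wt].
split=> i ii.
  by have := wst i; rewrite mem_undup mem_cat ii => /(_ isT) [].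
by have := wst i; rewrite mem_undup mem_cat ii orbT => /(_ isT) [].
Qed.

(** The product sigma-algebra on [I -> R]. Laws of whole families are compared on it, through the
    generating cylinders. *)
Definition env := g_sigma_algebraType cylinders.

Lemma measurable_coord (i : I) : measurable_fun setT (fun w : env => w i).
Proof.
move=> _ B mB; rewrite setTI; apply: sub_sigma_algebra.
exists [:: i], (fun=> B); split => //.
apply/seteqP; split => w /=; last by apply; rewrite mem_seq1.
by move=> Bw j; rewrite mem_seq1 => /eqP ->.
Qed.

End cylinders.
Arguments env R I : clear implicits.

Section law.
Context {d : measure_display} {T : measurableType d} {R : realType}.
Variable P : probability T R.

Lemma preimage_cylinder (I : eqType) (V : I -> T -> R) s B :
  (fun om i => V i om) @^-1` cylinder s B =
  \big[setI/setT]_(i <- s) (V i @^-1` B i).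
Proof.
apply/seteqP; split => [om|om].
  elim: s => [|i s ih] /= h; first by rewrite big_nil.
  rewrite big_cons; split; first by apply: h; rewrite mem_head.
  by apply: ih => j js; apply: h; rewrite inE js orbT.
elim: s => [|i s ih] /= ; first by move=> _ j.
rewrite big_cons => -[Bi /ih h] j.
by rewrite inE => /orP[/eqP ->//|]; exact: h.
Qed.

Lemma measurable_cyl (I : eqType) (V : I -> T -> R) s (B : I -> set R) :
  (forall i, measurable_fun setT (V i)) -> (forall i, measurable (B i)) ->
  measurable (\big[setI/setT]_(i <- s) (V i @^-1` B i)).
Proof.
move=> mV mB; elim/big_ind : _ => //; first exact: measurableI.
by move=> i _; rewrite -[X in measurable X]setTI; exact: mV.
Qed.

Lemma measurable_env (I : eqType) (V : I -> T -> R) :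
  (forall i, measurable_fun setT (V i)) ->
  measurable_fun setT ((fun om i => V i om) : T -> env R I).
Proof.
move=> mV; apply: (@measurability _ _ T (env R I) _ _ cylinders) => // _ [_ [s [B [us mB ->]]] <-].
rewrite setTI preimage_cylinder.
exact: measurable_cyl.
Qed.

(** Two finite measures in [A] agree on the pi-system of cylinders. Taking [C = setT] and [c = 1]
    compares two laws; taking [V' = V] and [c = P C] gives independence from an event. *)
Lemma env_measure_unique (I : eqType) (V V' : I -> T -> R) (C : set T)
    (c : {nonneg R}) :
  (forall i, measurable_fun setT (V i)) ->
  (forall i, measurable_fun setT (V' i)) -> measurable C ->
  (forall s (B : I -> set R), uniq s -> (forall i, measurable (B i)) ->
    P (\big[setI/setT]_(i <- s) (V i @^-1` B i) `&` C) =
    (c%:num%:E * P (\big[setI/setT]_(i <- s) (V' i @^-1` B i)))%E) ->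
  forall A : set (env R I), measurable A ->
    P ((fun om i => V i om) @^-1` A `&` C) =
    (c%:num%:E * P ((fun om i => V' i om) @^-1` A))%E.
Proof.
move=> mV mV' mC VV' A mA.
pose PhiV : T -> env R I := fun om i => V i om.
pose PhiV' : T -> env R I := fun om i => V' i om.
have mPV : measurable_fun setT PhiV by exact: measurable_env.
have mPV' : measurable_fun setT PhiV' by exact: measurable_env.
pose m1 : {measure set env R I -> \bar R} := pushforward (mrestr P mC) PhiV.
pose m2 : {measure set env R I -> \bar R} := mscale c (pushforward P PhiV').
change (m1 mPV A = m2 mPV' A).
apply: (@measure_unique _ R (env R I) cylinders (fun=> setT)) => //.
- exact: cylinders_setI.
- move=> _; exists [::], (fun=> setT); split => //.
  by apply/seteqP; split.
- by rewrite bigcup_const.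
- move=> _ [s [B [us mB ->]]].
  have -> : m2 mPV' (cylinder s B) =
    (c%:num%:E * P (PhiV' @^-1` cylinder s B))%E by [].
  have -> : m1 mPV (cylinder s B) = P (PhiV @^-1` cylinder s B `&` C) by [].
  by rewrite (preimage_cylinder V) (preimage_cylinder V') VV'.
- move=> _; rewrite /m1 /= /pushforward /mrestr preimage_setT setTI.
  by rewrite (le_lt_trans (probability_le1 _ _)) ?ltry.
Qed.

End law.

Section independence.
Context {d : measure_display} {T : measurableType d} {R : realType}.
Variable P : probability T R.

Definition law_of (d' : measure_display) (U : measurableType d') (f : T -> U)
    (mf : measurable_fun setT f) : probability U R :=
  distribution P
    (HB.pack f (isMeasurableFun.Build _ _ _ _ f mf) : {RV P >-> U}).

Lemma ge0_integral_law_of (d' : measure_display) (U : measurableType d')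
    (f : T -> U) (mf : measurable_fun setT f) (g : U -> R) :
  measurable_fun setT g -> (forall x, 0 <= g x) ->
  (\int[law_of mf]_x (g x)%:E = \int[P]_om (g (f om))%:E)%E.
Proof.
move=> mg g0; rewrite ge0_integral_pushforward ?preimage_setT//.
  exact/measurable_EFinP.
by move=> x _; rewrite lee_fin.
Qed.

Lemma env_independent (I : eqType) (V : I -> T -> R) (C : set T) :
  (forall i, measurable_fun setT (V i)) -> measurable C ->
  (forall s (B : I -> set R), uniq s -> (forall i, measurable (B i)) ->
    P (\big[setI/setT]_(i <- s) (V i @^-1` B i) `&` C) =
    (P C * P (\big[setI/setT]_(i <- s) (V i @^-1` B i)))%E) ->
  forall A : set (env R I), measurable A ->
    P ((fun om i => V i om) @^-1` A `&` C) =
    (P C * P ((fun om i => V i om) @^-1` A))%E.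
Proof.
move=> mV mC VC A mA.
pose c : {nonneg R} := NngNum (fine_ge0 (measure_ge0 P C)).
have PC : P C = c%:num%:E by rewrite fineK// fin_num_measure.
by rewrite PC; apply: env_measure_unique => // s B us mB; rewrite VC// PC.
Qed.

(** Independence identifies the law of the pair with the product of the two laws; Tonelli's theorem
    does the rest. *)
Lemma expectation_independent (U1 U2 : T -> R) :
  measurable_fun setT U1 -> measurable_fun setT U2 ->
  (forall om, 0 <= U1 om) -> (forall om, 0 <= U2 om) ->
  (forall A B : set R, measurable A -> measurable B ->
    P (U1 @^-1` A `&` U2 @^-1` B) = (P (U1 @^-1` A) * P (U2 @^-1` B))%E) ->
  (\int[P]_om (U1 om * U2 om)%:E =
   \int[P]_om (U1 om)%:E * \int[P]_om (U2 om)%:E)%E.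
Proof.
move=> mU1 mU2 U10 U20 indU.
have mU12 : measurable_fun setT (fun om => (U1 om, U2 om)).
  exact/measurable_fun_pair.
pose m1 := law_of mU1; pose m2 := law_of mU2; pose m12 := law_of mU12.
(* Absolute values make [f] nonnegative on the whole plane, as Tonelli's theorem asks; they change
   nothing on the range of [U1] and [U2]. *)
pose f (z : (R * R)%type) : R := `|z.1| * `|z.2|.
have mf : measurable_fun [set: R * R] f.
  by apply: measurable_funM; exact: measurableT_comp.
have f0 z : 0 <= f z by rewrite mulr_ge0.
have e12 : (\int[m12]_z (f z)%:E = \int[m1 \x m2]_z (f z)%:E)%E.
  apply: eq_measure_integral => A mA _.
  by apply/esym; apply: product_measure_unique.
transitivity (\int[m12]_z (f z)%:E)%E.
  rewrite [RHS]ge0_integral_law_of//.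
  by apply: eq_integral => om _; rewrite /f /= (ger0_norm (U10 _)) (ger0_norm (U20 _)).
have mn : measurable_fun setT (fun y : R => `|y|%:E).
  by apply/measurable_EFinP; exact: normr_measurable.
have pos (U : T -> R) (mU : measurable_fun setT U) : (forall om, 0 <= U om) ->
    (\int[law_of mU]_y `|y|%:E = \int[P]_om (U om)%:E)%E.
  move=> Y0; rewrite (ge0_integral_law_of mU (g := fun y => `|y|))//.
  by apply: eq_integral => om _ /=; rewrite (ger0_norm (Y0 _)).
rewrite e12 fubini_tonelli1//; last exact/measurable_EFinP.
transitivity (\int[m1]_x (`|x|%:E * \int[m2]_y `|y|%:E))%E.
  apply: eq_integral => x _; rewrite /fubini_F /f /=.
  under eq_integral do rewrite EFinM.
  by rewrite ge0_integralZl//= ?lee_fin// => y _; rewrite lee_fin.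
have m2ge0 : (0 <= \int[m2]_y `|y|%:E)%E by apply: integral_ge0.
by rewrite ge0_integralZr//= !pos.
Qed.

End independence.

Section iid.
Context {d : measure_display} {T : measurableType d} {R : realType}.
Variables (P : probability T R) (X : T -> R).

(** With bit strings as indices, a subtree is reached by prepending a bit. Evaluating every factor
    at [X] puts independence and the common law into one formula. *)
Definition iid (V : seq bool -> T -> R) : Prop :=
  (forall u, measurable_fun setT (V u)) /\
  forall (s : seq (seq bool)) (B : seq bool -> set R),
    uniq s -> (forall u, measurable (B u)) ->
    P (\big[setI/setT]_(u <- s) (V u @^-1` B u)) =
    (\prod_(u <- s) P (X @^-1` B u))%E.

Lemma iid_shift V b : iid V -> iid (fun u => V (b :: u)).
Proof.
move=> [mV iV]; split => [u//|s B us mB].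
have := iV (map (cons b) s) (fun u => B (behead u)).
rewrite !big_map /=; apply => //.
by rewrite map_inj_uniq// => x y [].
Qed.

Lemma iid_law V V' : iid V -> iid V' ->
  forall A : set (env R (seq bool)), measurable A ->
  P ((fun om u => V u om) @^-1` A) = P ((fun om u => V' u om) @^-1` A).
Proof.
move=> [mV iV] [mV' iV'] A mA.
rewrite -[LHS]mul1e -[X in P X]setIT.
rewrite (@env_measure_unique _ _ _ P _ V V' setT 1%:nng)// => [|s B us mB].
  by rewrite !mul1e.
by rewrite setIT mul1e iV// iV'.
Qed.

Lemma iid_expectation V V' (F : (seq bool -> R) -> R) : iid V -> iid V' ->
  measurable_fun setT (F : env R (seq bool) -> R) -> (forall w, 0 <= F w) ->
  (\int[P]_om (F (fun u => V u om))%:E =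
   \int[P]_om (F (fun u => V' u om))%:E)%E.
Proof.
move=> iV iV' mF F0.
have mE (U : seq bool -> T -> R) : iid U ->
  measurable_fun setT ((fun om i => U i om) : T -> env R (seq bool)).
  by move=> [mU _]; exact: measurable_env.
rewrite -(ge0_integral_law_of P (mE _ iV))// -(ge0_integral_law_of P (mE _ iV'))//.
by apply: eq_measure_integral => A mA _; exact: iid_law.
Qed.

(** The root weight is independent of all the others; a pair [(b, u)] stands for the nonempty
    address [b :: u]. *)
Lemma iid_root V (A : set (env R (bool * seq bool)%type)) (B : set R) :
  iid V -> measurable A -> measurable B ->
  P ((fun om bu => V (bu.1 :: bu.2) om) @^-1` A `&` V [::] @^-1` B) =
  (P (V [::] @^-1` B) * P ((fun om bu => V (bu.1 :: bu.2) om) @^-1` A))%E.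
Proof.
move=> [mV iV] mA mB; apply: (env_independent (V := fun bu => V (bu.1 :: bu.2))) => //.
  by rewrite -[X in measurable X]setTI; exact: mV.
move=> s C us mC.
pose D u := if u is b :: u' then C (b, u') else B.
have mD u : measurable (D u) by case: u => [|b u]; [exact: mB|exact: mC].
pose c (bu : bool * seq bool) := bu.1 :: bu.2.
have ucs : uniq (map c s) by rewrite map_inj_uniq// => -[x u] [y v] [-> ->].
have -> : C = fun bu => D (c bu) by apply/funext => -[].
have := iV (map c s) D ucs mD; rewrite !big_map => ->.
have := iV [:: [::]] D isT mD; rewrite !big_cons !big_nil setIT mule1 => ->.
have := iV ([::] :: map c s) D; rewrite !big_cons !big_map setIC /=; apply => //.
by rewrite ucs andbT; apply/mapP => -[].
Qed.

(** [env_independent] is used twice: on the [false] subtree with the event of the other one fixed,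
    then on the [true] subtree with a cylinder event fixed. *)
Lemma iid_subtrees V (A0 A1 : set (env R (seq bool))) :
  iid V -> measurable A0 -> measurable A1 ->
  P ((fun om u => V (false :: u) om) @^-1` A0 `&`
     (fun om u => V (true :: u) om) @^-1` A1) =
  (P ((fun om u => V (false :: u) om) @^-1` A0) *
   P ((fun om u => V (true :: u) om) @^-1` A1))%E.
Proof.
move=> iV mA0 mA1.
have [mV IV] := iV.
have [mV0 IV0] := iid_shift false iV.
have [mV1 IV1] := iid_shift true iV.
have mpre b (A : set (env R (seq bool))) : measurable A ->
    measurable ((fun om u => V (b :: u) om) @^-1` A).
  move=> mA; rewrite -[X in measurable X]setTI.
  by apply: (measurable_env (V := fun u => V (b :: u))).
rewrite muleC; apply: (env_independent (V := fun u => V (false :: u))) => //.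
  exact: mpre.
move=> s B us mB.
rewrite setIC muleC; apply: (env_independent (V := fun u => V (true :: u))) => //.
  exact: measurable_cyl.
move=> t C ut mC; rewrite IV0// IV1//.
pose D u := if u is b :: u' then if b then C u' else B u' else setT.
have mD u : measurable (D u) by case: u => [|[] u]; [exact: measurableT|exact: mC|exact: mB].
have := IV (map (cons false) s ++ map (cons true) t) D.
rewrite !big_cat /= !big_map /= setIC; apply => //.
rewrite cat_uniq !map_inj_uniq ?us ?ut ?andbT /=; first last.
- by move=> ? ? [].
- by move=> ? ? [].
by apply/hasPn => _ /mapP[x _ ->]; apply/mapP => -[].
Qed.

(** Peels the root weight off an expectation, the step on which the inductions over the tree
    rest. *)
Lemma iid_root_expectation V (g : R -> R) (F : (bool * seq bool -> R) -> R) :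
  iid V -> measurable_fun setT X -> measurable_fun setT g ->
  measurable_fun setT (F : env R (bool * seq bool)%type -> R) ->
  (forall x, 0 <= g x) -> (forall w, 0 <= F w) ->
  (\int[P]_om (g (V [::] om) * F (fun bu => V (bu.1 :: bu.2) om))%:E =
   \int[P]_om (g (X om))%:E * \int[P]_om (F (fun bu => V (bu.1 :: bu.2) om))%:E)%E.
Proof.
move=> iV mX mg mF g0 F0; have [mV IV] := iV.
have mE : measurable_fun setT
    ((fun om bu => V (bu.1 :: bu.2) om) : T -> env R (bool * seq bool)%type).
  by apply: (measurable_env (V := fun bu => V (bu.1 :: bu.2))).
rewrite expectation_independent//; first last.
- move=> A B mA mB.
  have mgA : measurable (g @^-1` A) by rewrite -[X in measurable X]setTI; exact: mg.
  have mFB : measurable ((F : env R _ -> R) @^-1` B).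
    by rewrite -[X in measurable X]setTI; exact: mF.
  by have := iid_root iV mFB mgA; rewrite setIC; apply.
- exact: (measurableT_comp mF mE).
- exact: measurableT_comp.
congr (_ * _)%E.
rewrite -(ge0_integral_law_of P (mV [::]))// -(ge0_integral_law_of P mX)//.
apply: eq_measure_integral => A mA _; rewrite /= /pushforward.
by have := IV [:: [::]] (fun=> A); rewrite !big_cons !big_nil setIT mule1; apply.
Qed.

End iid.

(** * Masses in the cascade tree *)

Section tree_masses.
Context {R : realType}.
Implicit Types w : seq bool -> R.

Definition subtree w (b : bool) : seq bool -> R := fun u => w (b :: u).

(* An environment [w] weights the nodes of the binary tree, addressed by their
   bit strings.  With [I] the dyadic interval of address [v], [cmass v r w] is
   [mu_(size v + r) I], [tmass r w] is [mu_r [0, 1]], and [maxmass m r w] is the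
   largest [mu_(m + r)]-mass of an interval of level [m].  The absolute values
   make these functionals nonnegative on every environment, not only on the
   almost sure event where all weights are positive. *)
Fixpoint tmass (r : nat) w : R :=
  if r is r'.+1 then
    `|w [::]| * ((tmass r' (subtree w false) + tmass r' (subtree w true)) / 2)
  else 1.

Fixpoint cmass (v : seq bool) (r : nat) w : R :=
  if v is b :: v' then `|w [::]| * (cmass v' r (subtree w b) / 2) else tmass r w.

Fixpoint maxmass (m r : nat) w : R :=
  if m is m'.+1 then `|w [::]| *
    (Num.max (maxmass m' r (subtree w false)) (maxmass m' r (subtree w true)) / 2)
  else tmass r w.

Lemma tmass_ge0 r w : 0 <= tmass r w.
Proof.
by elim: r w => [|r ih] w //=; rewrite mulr_ge0// divr_ge0// addr_ge0.
Qed.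

Lemma cmass_ge0 v r w : 0 <= cmass v r w.
Proof.
elim: v w => [|b v ih] w /=; first exact: tmass_ge0.
by rewrite mulr_ge0// divr_ge0.
Qed.

Lemma maxmass_ge0 m r w : 0 <= maxmass m r w.
Proof.
elim: m w => [|m ih] w /=; first exact: tmass_ge0.
by rewrite mulr_ge0// divr_ge0// le_max ih.
Qed.

Lemma cmass_le_maxmass v r w : cmass v r w <= maxmass (size v) r w.
Proof.
elim: v w => [|b v ih] w //=.
rewrite ler_wpM2l// ler_wpM2r ?invr_ge0// le_max.
by case: b; rewrite ih ?orbT.
Qed.

Section measurability.
Context {d : measure_display} {T : measurableType d}.
Implicit Types V : seq bool -> T -> R.

Lemma measurable_tmass r V : (forall u, measurable_fun setT (V u)) ->
  measurable_fun setT (fun x => tmass r (fun u => V u x)).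
Proof.
elim: r V => [|r ih] V mV /=; first exact: measurable_cst.
apply: measurable_funM; first exact: measurableT_comp.
apply: measurable_funM => //; apply: measurable_funD.
  exact: (ih (fun u => V (false :: u))).
exact: (ih (fun u => V (true :: u))).
Qed.

Lemma measurable_cmass v r V : (forall u, measurable_fun setT (V u)) ->
  measurable_fun setT (fun x => cmass v r (fun u => V u x)).
Proof.
elim: v V => [|b v ih] V mV /=; first exact: measurable_tmass.
apply: measurable_funM; first exact: measurableT_comp.
by apply: measurable_funM => //; exact: (ih (fun u => V (b :: u))).
Qed.

Lemma measurable_maxmass m r V : (forall u, measurable_fun setT (V u)) ->
  measurable_fun setT (fun x => maxmass m r (fun u => V u x)).
Proof.
elim: m V => [|m ih] V mV /=; first exact: measurable_tmass.
apply: measurable_funM; first exact: measurableT_comp.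
apply: measurable_funM => //; apply: measurable_maxr.
  exact: (ih (fun u => V (false :: u))).
exact: (ih (fun u => V (true :: u))).
Qed.

End measurability.
End tree_masses.

Lemma measurable_fun_powR {d : measure_display} {T : measurableType d}
    {R : realType} (f : T -> R) (s : R) :
  measurable_fun setT f -> measurable_fun setT (fun x => f x `^ s).
Proof. exact: (measurableT_comp (measurable_powR s)). Qed.

(** Young's inequality for [y^s] and [1] with exponents [1/s] and [1/(1 - s)]; the case [s = 1],
    where the second one degenerates, is separate. *)
Lemma powR_le_affine {R : realType} (s y : R) : 0 < s <= 1 -> 0 <= y ->
  y `^ s <= s * y + (1 - s).
Proof.
move=> /andP[s0]; rewrite le_eqVlt => /predU1P[->|s1] y0.
  by rewrite powRr1// mul1r subrr addr0.
have s1' : 0 < 1 - s by rewrite subr_gt0.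
have := @conjugate_powR R (y `^ s) 1 s^-1 (1 - s)^-1 (powR_ge0 _ _) ler01.
rewrite !invr_gt0 s0 s1' !invrK mulr1 powR1 -powRrM mulfV ?gt_eqF// powRr1//.
rewrite mul1r [y * s]mulrC; apply => //.
by rewrite addrC subrK.
Qed.

(** * Moments of interval masses and decay of the largest mass *)

Section expectations.
Context {d : measure_display} {T : measurableType d} {R : realType}.
Variables (P : probability T R) (X : T -> R).
Hypothesis mX : measurable_fun setT X.
Hypothesis EX : (\int[P]_om (`|X om|)%:E = 1)%E.
Implicit Types V : seq bool -> T -> R.

Let msub b : forall u, measurable_fun setT
  (fun w : env R (bool * seq bool)%type => w (b, u)).
Proof. by move=> u; exact: measurable_coord. Qed.

Lemma expectation_tmass r V : iid P X V ->
  (\int[P]_om (tmass r (fun u => V u om))%:E = 1)%E.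
Proof.
elim: r V => [|r ih] V iV /=.
  by rewrite integral_cst// mul1e; exact: probability_setT.
pose F (w : bool * seq bool -> R) :=
  (tmass r (fun u => w (false, u)) + tmass r (fun u => w (true, u))) / 2.
rewrite (iid_root_expectation (g := Num.norm) (F := F) iV)//.
- rewrite EX mul1e; under eq_integral do rewrite EFinM EFinD.
  have mt b := measurable_tmass r (iid_shift b iV).1.
  rewrite ge0_integralZr//; last 2 first.
    apply: emeasurable_funD; apply/measurable_EFinP; exact: mt.
    by move=> om _; rewrite adde_ge0// lee_fin tmass_ge0.
  rewrite ge0_integralD//; last 4 first.
    by move=> om _; rewrite lee_fin tmass_ge0.
    exact/measurable_EFinP/mt.
    by move=> om _; rewrite lee_fin tmass_ge0.
    exact/measurable_EFinP/mt.
  rewrite (ih _ (iid_shift false iV)) (ih _ (iid_shift true iV)).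
  by rewrite -EFinD -EFinM; congr EFin; field.
- apply: measurable_funM => //; apply: measurable_funD.
    exact: measurable_tmass (msub false).
  exact: measurable_tmass (msub true).
- by move=> w; rewrite divr_ge0// addr_ge0// tmass_ge0.
Qed.

(** Each ancestor of the interval contributes an independent factor [(|W| / 2)^s], of mean at most
    [2^-s b]. What remains is the mass of a whole cascade, whose [s]-th moment is at most 1 for
    every [r] by [powR_le_affine]. *)
Lemma expectation_cmass (s b : R) v r V : 0 < s <= 1 -> 0 <= b ->
  (\int[P]_om (`|X om| `^ s)%:E <= b%:E)%E -> iid P X V ->
  (\int[P]_om ((cmass v r (fun u => V u om)) `^ s)%:E <=
   ((2 `^ (- s) * b) ^+ size v)%:E)%E.
Proof.
move=> s01 b0 Xb; have /andP[s0 s1] := s01.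
elim: v V => [|c v ih] V iV /=.
  have mt := measurable_tmass r iV.1.
  apply: (@le_trans _ _ (\int[P]_om (s%:E * (tmass r (fun u => V u om))%:E + (1 - s)%:E))%E).
    apply: ge0_le_integral => //.
    + by move=> om _; rewrite lee_fin powR_ge0.
    + by apply/measurable_EFinP; exact: measurable_fun_powR.
    + by apply: emeasurable_funD => //; apply: emeasurable_funM => //; exact/measurable_EFinP.
    + by move=> om _; rewrite -EFinM -EFinD lee_fin powR_le_affine// tmass_ge0.
  have mt' : measurable_fun setT (fun om => (tmass r (fun u => V u om))%:E).
    exact/measurable_EFinP.
  have t0 om : (0 <= (tmass r (fun u => V u om))%:E)%E by rewrite lee_fin tmass_ge0.
  have s0' : (0 <= s%:E)%E by rewrite lee_fin ltW.
  rewrite ge0_integralD//; last 3 first.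
  + by move=> om _; rewrite mule_ge0.
  + exact: emeasurable_funM.
  + by move=> om _; rewrite lee_fin subr_ge0.
  rewrite ge0_integralZl//.
  have -> : (\int[P]_om (1 - s)%:E = (1 - s)%:E)%E.
    rewrite integral_cst// -[RHS]mule1; congr (_ * _)%E; exact: probability_setT.
  rewrite (expectation_tmass r iV) mule1.
  by rewrite -EFinD lee_fin expr0 addrC subrK.
pose F (w : bool * seq bool -> R) := (cmass v r (fun u => w (c, u)) / 2) `^ s.
pose g (x : R) := `|x| `^ s.
under eq_integral.
  move=> om _; rewrite powRM// ?divr_ge0 ?cmass_ge0//.
  rewrite -/(g (V [::] om)) -/(F (fun bu => V (bu.1 :: bu.2) om)); over.
rewrite (iid_root_expectation (g := g) (F := F) iV)//; last 4 first.
- by apply: measurable_fun_powR; exact: normr_measurable.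
- apply: measurable_fun_powR; apply: measurable_funM => //.
  exact: measurable_cmass (msub c).
- by move=> x; exact: powR_ge0.
- by move=> w; exact: powR_ge0.
rewrite exprS EFinM EFinM [((2 `^ _)%:E * _)%E]muleC -muleA.
apply: lee_pmul => //; first by apply: integral_ge0 => om _; rewrite lee_fin powR_ge0.
  by apply: integral_ge0 => om _; rewrite lee_fin powR_ge0.
have mc := measurable_cmass v r (iid_shift c iV).1.
rewrite (eq_integral (fun om => ((2 `^ (-s))%:E *
  ((cmass v r (fun u => V (c :: u) om)) `^ s)%:E)%E)); last first.
  move=> om _; rewrite /F powRM ?cmass_ge0 ?invr_ge0// -EFinM mulrC.
  by rewrite -powR_inv1// -powRrM mulN1r.
rewrite ge0_integralZl ?lee_fin ?powR_ge0//.
- apply: lee_wpmul2l; first by rewrite lee_fin powR_ge0.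
  exact: (ih _ (iid_shift c iV)).
- by apply/measurable_EFinP; exact: measurable_fun_powR.
- by move=> om _; rewrite lee_fin powR_ge0.
Qed.

Definition bigcell V (t : R) m r : set T :=
  [set om | t < maxmass m r (fun u => V u om)].

Lemma measurable_bigcell V t m r : iid P X V -> measurable (bigcell V t m r).
Proof.
move=> iV; have := measurable_maxmass m r iV.1.
move=> /(_ measurableT `]t, +oo[%classic (measurable_itv _)); rewrite setTI.
by rewrite (_ : _ @^-1` _ = bigcell V t m r)//; apply/seteqP; split => om /=;
  rewrite in_itv/= andbT.
Qed.

(* From [max a b + min a b = a + b] and [min a b >= t] on [{a > t, b > t}]. *)
Lemma expectation_maxmassS V (t : R) m r : 0 <= t -> iid P X V ->
  (\int[P]_om (maxmass m.+1 r (fun u => V u om))%:E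
    + (t / 2)%:E * (P (bigcell V t m r) * P (bigcell V t m r))
   <= \int[P]_om (maxmass m r (fun u => V u om))%:E)%E.
Proof.
move=> t0 iV.
pose a b om := maxmass m r (fun u => V (b :: u) om).
have ma b : measurable_fun setT (a b) := measurable_maxmass m r (iid_shift b iV).1.
have a0 b om : 0 <= a b om by exact: maxmass_ge0.
have menv : measurable_fun setT (maxmass m r : env R (seq bool) -> R).
  exact: (measurable_maxmass m r (@measurable_coord R (seq bool))).
have Ea b : (\int[P]_om (a b om)%:E =
    \int[P]_om (maxmass m r (fun u => V u om))%:E)%E.
  exact: (iid_expectation (iid_shift b iV) iV menv (maxmass_ge0 m r)).
pose C b := [set om | t < a b om].
have mC b : measurable (C b) := measurable_bigcell t m r (iid_shift b iV).
have mA : measurable [set w : env R (seq bool) | t < maxmass m r w].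
  have := menv measurableT `]t, +oo[%classic (measurable_itv _); rewrite setTI.
  by rewrite (_ : _ @^-1` _ = [set w : env R (seq bool) | t < maxmass m r w])//;
    apply/seteqP; split => om /=; rewrite in_itv/= andbT.
have PC b : P (C b) = P (bigcell V t m r).
  exact: (iid_law (iid_shift b iV) iV mA).
have PCC : P (C false `&` C true) = (P (bigcell V t m r) * P (bigcell V t m r))%E.
  by rewrite -{1}(PC false) -(PC true); exact: (iid_subtrees iV mA mA).
have -> : (\int[P]_om (maxmass m.+1 r (fun u => V u om))%:E =
           \int[P]_om (Num.max (a false om) (a true om) / 2)%:E)%E.
  pose F (w : bool * seq bool -> R) :=
    Num.max (maxmass m r (fun u => w (false, u))) (maxmass m r (fun u => w (true, u))) / 2.
  rewrite (iid_root_expectation (g := Num.norm) (F := F) iV) ?EX ?mul1e//.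
  - apply: measurable_funM => //; apply: measurable_maxr.
      exact: measurable_maxmass (msub false).
    exact: measurable_maxmass (msub true).
  - by move=> w; rewrite divr_ge0// le_max maxmass_ge0.
rewrite -PCC.
have -> : ((t / 2)%:E * P (C false `&` C true) =
   \int[P]_om ((t / 2)%:E * (\1_(C false `&` C true) om)%:E))%E.
  rewrite ge0_integralZl//.
  - rewrite integral_indic// ?setIT//; exact: measurableI.
  - by apply/measurable_EFinP/measurable_indic; exact: measurableI.
  - by rewrite lee_fin divr_ge0.
have mmax : measurable_fun setT (fun om => (Num.max (a false om) (a true om) / 2)%:E).
  by apply/measurable_EFinP; apply: measurable_funM => //; exact: measurable_maxr.
have mind : measurable_fun setT (fun om => ((t / 2)%:E * (\1_(C false `&` C true) om)%:E)%E).
  by apply: emeasurable_funM => //; apply/measurable_EFinP/measurable_indic; exact: measurableI.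
rewrite -ge0_integralD//; last 2 first.
- by move=> om _; rewrite lee_fin divr_ge0// le_max a0.
- by move=> om _; rewrite -EFinM lee_fin mulr_ge0// divr_ge0.
(* Both subtrees have the law of the whole tree, so the right-hand side is the average of their two
   expectations. *)
have -> : (\int[P]_om (maxmass m r (fun u => V u om))%:E =
  \int[P]_om ((a false om)%:E * (2^-1)%:E + (a true om)%:E * (2^-1)%:E))%E.
  rewrite ge0_integralD//.
  - rewrite !ge0_integralZr//; try by move=> om _; rewrite lee_fin.
    + rewrite !Ea -ge0_muleDr ?lee_fin// -EFinD.
      by rewrite (_ : 2^-1 + 2^-1 = 1 :> R) ?mule1//; field.
    + exact/measurable_EFinP.
    + exact/measurable_EFinP.
  - by move=> om _; rewrite -EFinM lee_fin mulr_ge0.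
  - by apply: emeasurable_funM => //; exact/measurable_EFinP.
  - by move=> om _; rewrite -EFinM lee_fin mulr_ge0.
  - by apply: emeasurable_funM => //; exact/measurable_EFinP.
apply: ge0_le_integral => //.
- move=> om _; rewrite -EFinM -EFinD lee_fin addr_ge0//.
    by rewrite divr_ge0// le_max a0.
  by rewrite mulr_ge0// divr_ge0.
- exact: emeasurable_funD.
- by apply: emeasurable_funD; apply: emeasurable_funM => //; exact/measurable_EFinP.
- move=> om _; rewrite -!EFinM -!EFinD lee_fin.
  have := a0 false om; have := a0 true om.
  rewrite indicE; case: (boolP (om \in C false `&` C true)) => /= [|_].
    rewrite inE => -[/=]; rewrite /C /= mulr1 => Cf Ct at0 af0.
    by case: (leP (a false om) (a true om)) => _; lra.
  by rewrite mulr0; case: (leP (a false om) (a true om)) => _; lra.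
Qed.

Lemma sum_bigcell V (t : R) r L : 0 <= t -> iid P X V ->
  (\sum_(m < L) (t / 2)%:E * (P (bigcell V t m r) * P (bigcell V t m r)) <= 1)%E.
Proof.
move=> t0 iV.
(* Keeping the expectation at level [L] makes the sum telescope; the induction starts from the total
   mass, of mean 1. *)
suff : (\int[P]_om (maxmass L r (fun u => V u om))%:E +
  \sum_(m < L) (t / 2)%:E * (P (bigcell V t m r) * P (bigcell V t m r)) <= 1)%E.
  apply: le_trans; rewrite leeDr//.
  by apply: integral_ge0 => om _; rewrite lee_fin maxmass_ge0.
elim: L => [|L ih]; first by rewrite big_ord0 adde0 expectation_tmass.
rewrite big_ord_recr /= addeCA addeC.
apply: le_trans ih; rewrite leeD2r//.
exact: expectation_maxmassS.
Qed.

End expectations.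

(** * Absence of atoms *)

Section no_atoms.
Context {d : measure_display} {T : measurableType d} {R : realType}.
Variables (P : probability T R) (X : T -> R).
Hypothesis mX : measurable_fun setT X.
Hypothesis EX : (\int[P]_om (`|X om|)%:E = 1)%E.

(** If the event has probability [p], then [L (t / 2) p^2 <= 1] for all [L], so [p = 0]. The depth
    [r0] may depend on the level, but [sum_bigcell] needs one depth for all levels: [F L r0] imposes
    a common one on the first [L] levels and increases with [r0]. *)
Lemma bigcell_negligible V (t : R) : 0 < t -> iid P X V ->
  P (\bigcap_m \bigcup_r0 \bigcap_(r in [set r | (r0 <= r)%N]) bigcell V t m r) = 0%E.
Proof.
move=> t0 iV; set N := \bigcap_m _.
have mA m r : measurable (bigcell V t m r) := measurable_bigcell t m r iV.
have mN : measurable N.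
  apply: bigcapT_measurable => m; apply: bigcupT_measurable => r0.
  by apply: bigcap_measurable => //; exists r0 => /=.
pose F L r0 := \bigcap_(m in [set m | (m < L)%N])
  \bigcap_(r in [set r | (r0 <= r)%N]) bigcell V t m r.
have mF L r0 : (0 < L)%N -> measurable (F L r0).
  move=> L0; apply: bigcap_measurable; first by exists 0%N.
  by move=> m _; apply: bigcap_measurable => //; exists r0 => /=.
have NF L : N `<=` \bigcup_r0 F L r0.
  move=> om Nom; elim: L => [|L [r0 _ Fr0]]; first by exists 0%N.
  have [r1 _ Fr1] := Nom L I.
  exists (maxn r0 r1) => // m /=; rewrite ltnS leq_eqVlt => /predU1P[->|mL] r /=.
    by rewrite geq_max => /andP[_ r1r]; exact: Fr1.
  by rewrite geq_max => /andP[r0r _]; exact: Fr0.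
pose p := fine (P N).
have PN : P N = p%:E by rewrite fineK// fin_num_measure.
have p0 : 0 <= p by rewrite fine_ge0.
(* The largest masses at different levels [m < L] share the budget of
   [sum_bigcell], so one of these events is improbable for large [L]. *)
have key L : (0 < L)%N -> L%:R * (t / 2 * (p * p)) <= 1.
  move=> L0.
  have PF r0 q : 0 <= q -> (q%:E <= P (F L r0))%E -> L%:R * (t / 2 * (q * q)) <= 1.
    move=> q0 qF; rewrite -lee_fin; apply: le_trans (sum_bigcell mX EX r0 L (ltW t0) iV).
    rewrite (_ : (L%:R * (t / 2 * (q * q)))%:E = \sum_(m < L) (t / 2 * (q * q))%:E)%E; last first.
      by rewrite sumEFin sumr_const card_ord mulr_natl.
    apply: lee_sum => m _; rewrite EFinM; apply: lee_wpmul2l.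
      by rewrite lee_fin divr_ge0// ltW.
    have qA : (q%:E <= P (bigcell V t m r0))%E.
      apply: (le_trans qF); apply: le_measure; rewrite ?inE//; first exact: mF.
      by move=> om /(_ m (ltn_ord m) r0); apply => /=.
    by rewrite EFinM; apply: lee_pmul.
  pose c := L%:R * (t / 2).
  have c0 : 0 < c by rewrite mulr_gt0 ?ltr0n// divr_gt0.
  (* Solved for [q], the bound becomes a closed condition, which survives the limit [r0 --> oo]. *)
  have cE q : 0 <= q -> (L%:R * (t / 2 * (q * q)) <= 1) = (q <= Num.sqrt c^-1).
    move=> q0; rewrite mulrA -/c mulrC -ler_pdivlMr// div1r -expr2.
    rewrite -[X in _ = (X <= _)]ger0_norm// -sqrtr_sqr ler_sqrt//.
    by rewrite invr_ge0 ltW.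
  rewrite cE// -lee_fin -PN.
  apply: (@le_trans _ _ (P (\bigcup_r0 F L r0))).
    apply: le_measure; rewrite ?inE//.
    by apply: bigcupT_measurable => r0; exact: mF.
  have cv : (P (F L r0) @[r0 --> \oo] --> P (\bigcup_r0 F L r0))%E.
    apply: nondecreasing_cvg_mu => //; first by move=> r0; exact: mF.
      by apply: bigcupT_measurable => r0; exact: mF.
    move=> r0 r1 r01; apply/subsetPset => om Fom m mL r /= r1r.
    by apply: Fom => //=; exact: leq_trans r01 r1r.
  apply: cvge_le cv; apply: nearW => r0.
  have Ffin : P (F L r0) = (fine (P (F L r0)))%:E.
    by rewrite fineK// fin_num_measure//; exact: mF.
  rewrite Ffin lee_fin -cE ?fine_ge0//.
  by apply: (PF r0); rewrite ?fine_ge0// -Ffin.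
have [p1|] := ltP 0 p; last by move=> p1; rewrite PN; congr EFin; apply/eqP; rewrite eq_le p1.
have a0 : 0 < t / 2 * (p * p) by rewrite !mulr_gt0.
have := archi_boundP (ltW (divr_gt0 ltr01 a0)).
rewrite ltr_pdivrMr// => h; have := key (Num.bound (1 / (t / 2 * (p * p)))).
have [L0|L0] := posnP (Num.bound (1 / (t / 2 * (p * p)))).
  by move: h; rewrite L0 mul0r ltr10.
by move=> /(_ L0); rewrite leNgt h.
Qed.

(** Complement of the null events for [t = 1 / (n + 1)]. The masses are small only for infinitely
    many depths [r], which is enough to bound a weak limit. *)
Lemma ae_small_cells V : iid P X V ->
  {ae P, forall om, forall t : R, 0 < t ->
    exists m, forall r0, exists2 r, (r0 <= r)%N & maxmass m r (fun u => V u om) <= t}.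
Proof.
move=> iV.
have h n : {ae P, forall om, exists m, forall r0, exists2 r, (r0 <= r)%N &
    maxmass m r (fun u => V u om) <= n.+1%:R^-1}.
  exists (\bigcap_m \bigcup_r0 \bigcap_(r in [set r | (r0 <= r)%N])
    bigcell V n.+1%:R^-1 m r); split.
  - apply: bigcapT_measurable => m; apply: bigcupT_measurable => r0.
    apply: bigcap_measurable; first by exists r0 => /=.
    by move=> r _; exact: (measurable_bigcell _ _ _ iV).
  - by apply: bigcell_negligible => //; rewrite invr_gt0.
  - move=> om /= nh m _; apply: contrapT => nm; apply: nh; exists m => r0.
    apply: contrapT => nr; apply: nm; exists r0 => // r /= r0r.
    rewrite /bigcell /= ltNge; apply/negP => le; apply: nr; by exists r.
have := ae_foralln h; apply: filterS => om hom t t0.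
have [m mh] := hom (Num.bound t^-1).
exists m => r0; have [r r0r rle] := mh r0; exists r => //.
apply: (le_trans rle); rewrite invf_ple ?posrE//.
by rewrite ltW// (lt_trans (archi_boundP _))// ?invr_ge0 ?ltr_nat// ltW.
Qed.

End no_atoms.

(** * Dyadic addresses and weak limits *)

Section words.

(* Most significant bit first, so that a prefix of an address is an ancestor. *)
Fixpoint bval (u : seq bool) : nat :=
  if u is b :: u' then (b * 2 ^ size u' + bval u')%N else 0%N.

Definition node (u : seq bool) : nat * nat := (size u, bval u).

Fixpoint words (n : nat) : seq (seq bool) :=
  if n is n'.+1 then
    map (cons false) (words n') ++ map (cons true) (words n')
  else [:: [::]].

Lemma bval_lt u : (bval u < 2 ^ size u)%N.
Proof.
elim: u => [|b u ih] //=; rewrite expnS mul2n -addnn.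
by case: b; rewrite ?mul1n ?mul0n ?add0n; [rewrite ltn_add2l|exact: ltn_addr].
Qed.

Lemma node_dyadic u : dyadic_index (node u).
Proof. exact: bval_lt. Qed.

Lemma node_inj : injective node.
Proof.
elim=> [|b u ih] [|c v] //= [suv].
have := bval_lt u; have := bval_lt v; rewrite suv => bv bu e.
have bc : b = c by case: b c e => -[] //; rewrite !(mul1n, mul0n); lia.
move: e; rewrite bc => e; congr cons; apply: ih; congr pair => //; lia.
Qed.

Lemma bval_rcons u b : bval (rcons u b) = ((bval u).*2 + b)%N.
Proof.
elim: u => [|c u ih] /=; first by rewrite muln1 addn0.
by rewrite size_rcons ih expnS; lia.
Qed.

Lemma mem_words n u : (u \in words n) = (size u == n).
Proof.
elim: n u => [|n ih] u /=; first by rewrite mem_seq1 size_eq0.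
rewrite mem_cat; case: u => [|b u] /=.
  by apply/negbTE; rewrite negb_or; apply/andP; split; apply/mapP => -[].
have inj c : injective (cons c : seq bool -> seq bool) by move=> ? ? [].
rewrite eqSS -ih; case: b; rewrite (mem_map (inj _)) ?orbT.
  by apply/orP/idP => [[/mapP[]//|//]|?]; right.
by apply/orP/idP => [[//|/mapP[]//]|?]; left.
Qed.

Lemma uniq_words n : uniq (words n).
Proof.
elim: n => [//|n ih] /=.
have inj c : injective (cons c : seq bool -> seq bool) by move=> ? ? [].
rewrite cat_uniq !map_inj_uniq// ih /= andbT.
by apply/hasPn => _ /mapP[x _ ->]; apply/mapP => -[].
Qed.

End words.

Section dyadic_points.
Context {R : realType}.
Implicit Types x y : R.

(** For [x > 0] the lower bound is strict because a common endpoint belongs to the interval on its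
    left; at [x = 0] it is an equality. *)
Lemma dyidx_itv j x : 0 <= x ->
  (dyidx j x)%:R <= x * 2 ^+ j <= (dyidx j x).+1%:R /\
  (0 < x -> (dyidx j x)%:R < x * 2 ^+ j).
Proof.
move=> x0; rewrite /dyidx; case: ltP => [xp|x0']; last first.
  have -> : x = 0 by apply/eqP; rewrite eq_le x0 x0'.
  by rewrite mul0r lexx ler01 ltxx.
have y0 : 0 < x * 2 ^+ j by rewrite mulr_gt0// exprn_gt0.
have c1 : (0 : int) <= Num.ceil (x * 2 ^+ j) - 1.
  by rewrite subr_ge0 -gtz0_ge1 ceil_gt0.
have := ceil_itv (x * 2 ^+ j) => /andP[lt le].
have E : (`|Num.ceil (x * 2 ^+ j) - 1|%N)%:R = (Num.ceil (x * 2 ^+ j) - 1)%:~R :> R.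
  by rewrite -[in RHS](gez0_abs c1).
rewrite -[`|_|.+1%:R]natr1 E; split=> [|_]; last exact: lt.
by rewrite (ltW lt)/= intrB subrK.
Qed.

Lemma dyidx_half j x : 0 <= x -> (dyidx j.+1 x)./2 = dyidx j x.
Proof.
move=> x0; have [xp|x0'] := ltP 0 x; last by rewrite /dyidx x0'.
have [/andP[_ le1] /(_ xp) lt1] := dyidx_itv j.+1 x0.
have [/andP[_ le2] /(_ xp) lt2] := dyidx_itv j x0.
move: (dyidx j.+1 x) (dyidx j x) le1 lt1 le2 lt2 => k' k.
rewrite exprS mulrCA; set y := x * 2 ^+ j.
move=> le1 lt1 le2 lt2.
have hb : k'%:R = (odd k')%:R + 2 * (k'./2)%:R :> R.
  by rewrite -[in LHS](odd_double_half k') natrD -mul2n natrM.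
have b0 : (0 <= (odd k')%:R :> R) && ((odd k')%:R <= 1 :> R).
  by rewrite ler0n lern1 leq_b1.
rewrite -[k'.+1%:R]natr1 hb in le1; rewrite hb in lt1; rewrite -[k.+1%:R]natr1 in le2.
have hk : (k'./2)%:R < k.+1%:R :> R by rewrite -[k.+1%:R]natr1; lra.
have kh : k%:R < (k'./2).+1%:R :> R by rewrite -[(k'./2).+1%:R]natr1; lra.
by rewrite !ltr_nat in hk kh; lia.
Qed.

Lemma dyidx_lt j x : 0 <= x <= 1 -> (dyidx j x < 2 ^ j)%N.
Proof.
move=> /andP[x0 x1]; have [xp|x0'] := ltP 0 x; last first.
  by rewrite /dyidx x0' expn_gt0.
have [_ /(_ xp)] := dyidx_itv j x0 => lt.
by rewrite -(ltr_nat R) natrX (lt_le_trans lt)// ler_piMl//.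
Qed.

Lemma dyidx_near m x y : 0 <= x -> 0 <= y -> `|y - x| < 2 * 2 ^- m ->
  (dyidx m y <= dyidx m x + 2)%N.
Proof.
move=> x0 y0; rewrite ltr_norml => /andP[_ yx].
have [/andP[_ le1] _] := dyidx_itv m x0.
have [/andP[le2 _] _] := dyidx_itv m y0.
rewrite -ltnS -addnS -(ltr_nat R) natrD.
apply: (le_lt_trans le2); rewrite -[_.+1%:R]natr1 in le1.
have : (y - x) * 2 ^+ m < 2.
  by rewrite -ltr_pdivlMr// exprn_gt0.
rewrite mulrBl => h; rewrite (_ : 3%:R = 2 + 1 :> R)//; lra.
Qed.

(** The address of [I_n(x)]: by [dyidx_half], the parity of the index is the bit that completes the
    address of the parent. *)
Fixpoint word (n : nat) x : seq bool :=
  if n is n'.+1 then rcons (word n' x) (odd (dyidx n x)) else [::].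

Lemma size_word n x : size (word n x) = n.
Proof. by elim: n => //= n ih; rewrite size_rcons ih. Qed.

Lemma bval_word n x : 0 <= x <= 1 -> bval (word n x) = dyidx n x.
Proof.
move=> x01; elim: n => [|n ih].
  by have := @dyidx_lt 0 x x01; rewrite expn0 ltnS leqn0 => /eqP ->.
rewrite /word -/word bval_rcons ih -dyidx_half; last by case/andP: x01.
by rewrite addnC odd_double_half.
Qed.

Lemma node_word n x : 0 <= x <= 1 -> node (word n x) = (n, dyidx n x).
Proof. by move=> x01; rewrite /node size_word bval_word. Qed.

Lemma take_word n j x : (j <= n)%N -> take j (word n x) = word j x.
Proof.
elim: n => [|n ih]; first by rewrite leqn0 => /eqP ->.
rewrite leq_eqVlt => /predU1P[->|]; first by rewrite take_oversize// size_word.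
by rewrite ltnS => jn /=; rewrite -cats1 takel_cat ?size_word// ih.
Qed.

(** Index distance 2 is what captures all points of [[0, 1]] at distance less than [2 * 2^-m] from
    [x], where the cutoff of [weak_limit_ball_le] can be nonzero. *)
Definition nearby (m : nat) x : seq (seq bool) :=
  [seq v <- words m | (bval v <= dyidx m x + 2)%N && (dyidx m x <= bval v + 2)%N].

Lemma size_nearby m x : (size (nearby m x) <= 5)%N.
Proof.
have := @uniq_leq_size _ (map bval (nearby m x)) (iota (dyidx m x - 2) 5).
rewrite size_map size_iota; apply.
  rewrite map_inj_in_uniq ?filter_uniq ?uniq_words// => u v.
  rewrite !mem_filter !mem_words => /andP[_ /eqP su] /andP[_ /eqP sv] uv.
  by apply: node_inj; rewrite /node su sv uv.
move=> k /mapP[v]; rewrite mem_filter => /andP[/andP[h1 h2] _] ->.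
by rewrite mem_iota; lia.
Qed.

Lemma word_nearby m x y : 0 <= x <= 1 -> 0 <= y <= 1 -> `|y - x| < 2 * 2 ^- m ->
  word m y \in nearby m x.
Proof.
move=> x01 y01 yx; rewrite mem_filter mem_words size_word eqxx andbT.
have [x0 _] := andP x01; have [y0 _] := andP y01.
by rewrite bval_word// !dyidx_near// distrC.
Qed.

End dyadic_points.

Section path_weights.
Context {R : realType}.
Implicit Types w : seq bool -> R.

(** The constant value of the density [w_n] on the interval of address [q], with [n = size q]. Only
    proper prefixes count, since [w_n] stops at level [n - 1]. *)
Definition pweight w (q : seq bool) : R := \prod_(j < size q) w (take j q).

Lemma pweight_cons w b q : pweight w (b :: q) = w [::] * pweight (subtree w b) q.
Proof. by rewrite /pweight /= big_ord_recl take0. Qed.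

Lemma pweight_ge0 w q : (forall u, 0 <= w u) -> 0 <= pweight w q.
Proof. by move=> w0; apply: prodr_ge0. Qed.

Lemma tmassE r w : (forall u, 0 <= w u) ->
  tmass r w = \sum_(u <- words r) pweight w u * 2 ^- r.
Proof.
elim: r w => [|r ih] w w0 /=.
  by rewrite big_seq1 /pweight big_ord0 mul1r expr0 invr1.
rewrite !ih ?ger0_norm//; last 2 first.
- by move=> u; exact: w0.
- by move=> u; exact: w0.
rewrite big_cat !big_map /= mulrDl mulrDr !mulr_suml !mulr_sumr.
by congr (_ + _); apply: eq_bigr => u _;
  rewrite pweight_cons exprS invfM; ring.
Qed.

Lemma cmassE v r w : (forall u, 0 <= w u) ->
  cmass v r w = \sum_(u <- words r) pweight w (v ++ u) * 2 ^- (size v + r).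
Proof.
elim: v w => [|b v ih] w w0 /=; first by rewrite tmassE.
rewrite ih ?ger0_norm//; last by move=> u; exact: w0.
rewrite mulr_suml !mulr_sumr; apply: eq_bigr => u _.
by rewrite pweight_cons addSn exprS invfM; ring.
Qed.

End path_weights.

Section nonmeasurable_integral.
Context {d : measure_display} {T : measurableType d} {R : realType}.
Local Open Scope ereal_scope.

(* Unlike [ge0_le_integral], no measurability: the integral of a nonnegative
   function is the supremum over the simple functions below it. *)
Lemma ge0_integral_mono (mu : {measure set T -> \bar R}) (D : set T)
    (f g : T -> \bar R) :
  (forall x, D x -> 0 <= f x) -> (forall x, D x -> f x <= g x) ->
  \int[mu]_(x in D) f x <= \int[mu]_(x in D) g x.
Proof.
move=> f0 fg; rewrite !(integral_mkcond D) !ge0_integralTE//.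
- apply: ge_ereal_sup => _ [h hf <-]; apply: ereal_sup_ubound; exists h => // x.
  by apply: (le_trans (hf x)); exact: lee_restrict.
- by move=> x; apply: erestrict_ge0 => // y Dy; exact: le_trans (f0 _ Dy) (fg _ Dy).
- by move=> x; exact: erestrict_ge0.
Qed.

End nonmeasurable_integral.

Section cascade_bounds.
Context {d : measure_display} {T : measurableType d} {R : realType}.
Variables (W : nat * nat -> T -> R) (om : T).
Hypothesis W0 : forall nk, dyadic_index nk -> 0 <= W nk om.

Definition tree_env : seq bool -> R := fun u => W (node u) om.

Lemma tree_env_ge0 u : 0 <= tree_env u.
Proof. exact/W0/node_dyadic. Qed.

Lemma cascade_weightE N (x : R) : 0 <= x <= 1 ->
  cascade_weight W N om x = pweight tree_env (word N x).
Proof.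
move=> x01; rewrite /cascade_weight /pweight size_word.
by apply: eq_bigr => j _; rewrite take_word 1?ltnW// /tree_env node_word.
Qed.

(** The integrand is dominated by a step function: the value of the density on each interval of
    level [m + r] below [S], times the indicator of that interval. Overlaps of the closed intervals
    at endpoints only enlarge the bound, and [ge0_integral_mono] spares the measurability of the
    density. *)
Lemma cascade_integral_le (f : R -> R) (S : seq (seq bool)) m r :
  (forall v, v \in S -> size v = m) -> (forall y, 0 <= f y <= 1) ->
  (forall y, 0 <= y <= 1 -> f y != 0 -> word m y \in S) ->
  (\int[lebesgue_measure]_(x in `[0%R, 1%R])
     (f x * cascade_weight W (m + r) om x)%:E
   <= (\sum_(v <- S) cmass v r tree_env)%:E)%E.
Proof.
move=> Sm f01 fS.
pose N := (m + r)%N.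
pose J q : set R := `[(bval q)%:R / 2 ^+ N, (bval q).+1%:R / 2 ^+ N]%classic.
pose Q := [seq v ++ u | v <- S, u <- words r].
pose g (q : seq bool) (x : R) : \bar R :=
  ((pweight tree_env q)%:E * (\1_(J q) x)%:E)%E.
have p0 q : 0 <= pweight tree_env q by apply: pweight_ge0; exact: tree_env_ge0.
have g0 q x : (0 <= g q x)%E by rewrite /g -EFinM lee_fin mulr_ge0.
have mJ q : measurable (J q) by exact: measurable_itv.
have mi q : measurable_fun setT (fun x => (\1_(J q) x)%:E : \bar R).
  exact/measurable_EFinP/measurable_indic.
have mg q : measurable_fun setT (g q) by exact: emeasurable_funM.
apply: (@le_trans _ _ (\int[lebesgue_measure]_(x in `[0%R, 1%R]) (\sum_(q <- Q) g q x))%E).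
  apply: ge0_integral_mono => x /=; rewrite in_itv/= => x01.
    rewrite lee_fin mulr_ge0//; first by case/andP: (f01 x).
    by rewrite cascade_weightE.
  have [->|fx] := eqVneq (f x) 0.
    by rewrite mul0r; apply: sume_ge0.
  have wQ : word N x \in Q.
    apply/allpairsP; exists (word m x, drop m (word N x)) => /=; split.
    - exact: fS.
    - by rewrite mem_words size_drop size_word addKn.
    - by rewrite -{1}(cat_take_drop m (word N x)) take_word// leq_addr.
  apply: (@le_trans _ _ (g (word N x) x)).
    rewrite /g -EFinM lee_fin indicE mem_set.
      rewrite mulr1 -/N cascade_weightE// ler_piMl//.
      by case/andP: (f01 x).
    rewrite /J /= in_itv /= bval_word//.
    have /andP[x0 _] := x01; have [/andP[h1 h2] _] := dyidx_itv N x0.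
    by rewrite ler_pdivrMr ?exprn_gt0// h1 ler_pdivlMr ?exprn_gt0.
  by rewrite (big_rem _ wQ)/= leeDl//; apply: sume_ge0.
rewrite ge0_integral_sum//; last first.
  by move=> q; apply: measurable_funS (mg q).
rewrite big_allpairs_dep /=.
rewrite -sumEFin big_seq [leRHS]big_seq; apply: lee_sum => v vS.
rewrite cmassE; last exact: tree_env_ge0.
rewrite (Sm _ vS) -sumEFin big_seq [leRHS]big_seq; apply: lee_sum => u uw.
apply: (@le_trans _ _ (\int[lebesgue_measure]_x g (v ++ u) x)%E).
  by apply: ge0_subset_integral => //; exact: mg.
rewrite /g ge0_integralZl//; last 2 first.
- exact: mi.
- by rewrite lee_fin.
have -> : (\int[lebesgue_measure]_x (\1_(J (v ++ u)) x)%:E =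
    lebesgue_measure (J (v ++ u)))%E.
  rewrite integral_indic; last exact: mJ; last exact: measurableT.
  by rewrite (setIT (J (v ++ u)) : _ `&` setT = _).
rewrite EFinM; apply: lee_wpmul2l; first by rewrite lee_fin.
rewrite lebesgue_measure_itv /= lte_fin ltr_pM2r ?invr_gt0 ?exprn_gt0// ltr_nat ltnSn.
by rewrite -EFinB lee_fin -mulrBl -[_.+1%:R]natr1 [_ + 1]addrC addrK mul1r.
Qed.

Definition ball01 (m : nat) (x : R) : set R :=
  `[x - 2 ^- m, x + 2 ^- m]%classic `&` `[0, 1]%classic.

Lemma measurable_ball01 m x : measurable (ball01 m x).
Proof. by apply: measurableI; exact: measurable_itv. Qed.

Lemma weak_limit_ball_le (mu : {measure set R -> \bar R}) (x : R) (m : nat) (c : R) :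
  weak_limit_cascade W om mu -> 0 <= x <= 1 ->
  (forall r0, exists2 r, (r0 <= r)%N &
     \sum_(v <- nearby m x) cmass v r tree_env <= c) ->
  (mu (ball01 m x) <= c%:E)%E.
Proof.
move=> [muoo lim] x01 freq.
(* A continuous cutoff: 1 within [2^-m] of [x], 0 beyond [2 * 2^-m], affine in the distance in
   between. *)
pose f y : R := Num.max 0 (Num.min 1 (2 - 2 ^+ m * `|y - x|)).
have cf : continuous f.
  apply: (@max_fun_continuous _ _ R (cst 0)
    (cst 1 \min (fun y => 2 - 2 ^+ m * `|y - x|))) => [y|]; first exact: cvg_cst.
  apply: min_fun_continuous => y; first exact: cvg_cst.
  apply: cvgB; first exact: cvg_cst.
  apply: cvgM; first exact: cvg_cst.
  by apply: cvg_norm; apply: cvgB; [exact: cvg_id|exact: cvg_cst].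
have f01 y : 0 <= f y <= 1.
  by rewrite /f le_max lexx/= ge_max ler01 ge_min lexx.
have f1 y : ball01 m x y -> f y = 1.
  move=> [/=]; rewrite in_itv/= => /andP[h1 h2] _.
  have h : 2 ^+ m * `|y - x| <= 1.
    rewrite -ler_pdivlMl ?exprn_gt0// mulr1 ler_norml; apply/andP; split; lra.
  by rewrite /f min_l ?max_r//; lra.
have fS y : 0 <= y <= 1 -> f y != 0 -> word m y \in nearby m x.
  move=> y01 fy; apply: word_nearby => //.
  rewrite ltNge; apply: contra fy => h.
  have : 2 <= 2 ^+ m * `|y - x|.
    by rewrite -ler_pdivrMl ?exprn_gt0// mulrC.
  by move=> h2; rewrite /f max_l// ge_min; apply/orP; right; lra.
have Sm v : v \in nearby m x -> size v = m.
  by rewrite mem_filter mem_words => /andP[_ /eqP].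
apply: (@le_trans _ _ (\int[mu]_(y in `[0%R, 1%R]) (f y)%:E)%E).
  rewrite -[leLHS]mul1e -[in leLHS](integral_cst mu (measurable_ball01 m x) 1%E).
  apply: (@le_trans _ _ (\int[mu]_(y in ball01 m x) (f y)%:E)%E).
    by apply: ge0_integral_mono => // y /f1 ->.
  apply: ge0_subset_integral => //; first exact: measurable_ball01.
  - apply: (@measurable_funS _ _ _ _ setT) => //.
    by apply/measurable_EFinP; exact: continuous_measurable_fun.
  - by move=> y _; rewrite lee_fin; case/andP: (f01 y).
  - by move=> y [].
(* A limit above [c] would force all late integrals above [c], against the bound at one late [r]. *)
rewrite leNgt; apply/negP => cl.
have [n _ hn] : \forall n \near \oo, (c%:E < \int[lebesgue_measure]_(x in `[0%R, 1%R])
                 (f x * cascade_weight W n om x)%:E)%E.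
  exact: (lim f cf [set z | (c%:E < z)%E] (open_ereal_gt' cl)).
have [r nr rc] := freq n.
have := hn (m + r)%N (leq_trans nr (leq_addl _ _)); rewrite /= ltNge => /negP; apply.
by apply: (le_trans (cascade_integral_le r Sm f01 fS)); rewrite lee_fin.
Qed.

End cascade_bounds.

(** * Hausdorff measures *)

Section hausdorff.
Context {R : realType}.
Implicit Types (A K : set R) (rho : R -> R -> \bar R) (s : R).

Lemma diam_ge0 rho (U : set R) : (0 <= diam rho U)%E.
Proof. by apply: ereal_sup_ubound; left. Qed.

Lemma hcontent_ge0 A rho s delta K : (0 <= hcontent A rho s delta K)%E.
Proof.
apply: le_ereal_inf_tmp => _ [F _ <-].
by apply: nneseries_ge0 => i _ _; exact: poweR_ge0.
Qed.

Lemma hmeasure_eq0 A rho s K :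
  (forall delta eta, 0 < delta -> 0 < eta -> exists F : nat -> set R,
    [/\ K `<=` \bigcup_i F i,
        forall i, F i `<=` A /\ (diam rho (F i) <= delta%:E)%E &
        (\sum_(0 <= i <oo) (diam rho (F i)) `^ s <= eta%:E)%E]) ->
  hmeasure A rho s K = 0%E.
Proof.
move=> h; apply/eqP; rewrite eq_le; apply/andP; split.
  apply: ge_ereal_sup => _ [delta /= d0 <-].
  apply/lee_addgt0Pr => eta eta0; rewrite add0e.
  have [F [KF FA Feta]] := h _ _ d0 eta0.
  by apply: ge_ereal_inf; exists (\sum_(0 <= i <oo) (diam rho (F i)) `^ s)%E => //; exists F.
apply: (@le_trans _ _ (hcontent A rho s 1 K)); first exact: hcontent_ge0.
by apply: ereal_sup_ubound; exists 1 => /=.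
Qed.

Lemma hmeasure_eq0_cover A rho s K delta eta : hmeasure A rho s K = 0%E ->
  0 < delta -> 0 < eta -> exists F : nat -> set R,
    [/\ K `<=` \bigcup_i F i,
        forall i, F i `<=` A /\ (diam rho (F i) <= delta%:E)%E &
        (\sum_(0 <= i <oo) (diam rho (F i)) `^ s <= eta%:E)%E].
Proof.
move=> H0 d0 eta0.
have : (hcontent A rho s delta K < eta%:E)%E.
  apply: (@le_lt_trans _ _ 0%E); last by rewrite lte_fin.
  by rewrite -H0; apply: ereal_sup_ubound; exists delta.
move=> /ereal_inf_lt[_ [F [KF FA] <-] /ltW Feta].
by exists F.
Qed.

Lemma diam_cascade_le (mu : {measure set R -> \bar R}) (U : set R) :
  is_interval U -> (diam (cascade_metric mu) U <= mu U)%E.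
Proof.
move=> iU; have mU : measurable U := is_interval_measurable iU.
apply: ge_ereal_sup => _ [->|[x Ux [y Uy <-]]]; first exact: measure_ge0.
have sub a b : U a -> U b -> (mu `[a, b]%classic <= mu U)%E.
  move=> Ua Ub; apply: le_measure; rewrite ?inE//.
  by move=> z /=; rewrite in_itv/=; exact: iU.
by rewrite /cascade_metric; case: ifP => _; exact: sub.
Qed.

Lemma is_interval_ball01 m (x : R) : is_interval (ball01 m x).
Proof. by move=> a b [a1 a2] [b1 b2] c abc; split; apply: interval_is_interval abc. Qed.

(** Covering by the cells of level [m], the sum of [mu(F i)^s] is at most the largest
    [mu(F i)^(s - 1)] times the total mass. *)
Lemma hmeasure_cascade_gt1 (mu : {measure set R -> \bar R}) K s :
  K `<=` `[0, 1] -> (mu `[0%R, 1%R]%classic < +oo)%E -> 1 < s ->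
  (forall t, 0 < t -> exists m, forall x, 0 <= x <= 1 ->
     (mu (ball01 m x) <= t%:E)%E) ->
  hmeasure `[0, 1] (cascade_metric mu) s K = 0%E.
Proof.
move=> K01 muoo s1 small; apply: hmeasure_eq0 => delta eta d0 eta0.
have s10 : 0 < s - 1 by rewrite subr_gt0.
have s1n : s - 1 != 0 by rewrite gt_eqF.
pose M := fine (mu `[0, 1]%classic).
have ME : mu `[0, 1]%classic = M%:E by rewrite fineK// ge0_fin_numE.
have M0 : 0 <= M by rewrite fine_ge0.
(* Chosen so that [e M <= eta]; the [+ 1] covers the case [M = 0]. *)
pose e := eta / (M + 1).
have e0 : 0 < e by rewrite divr_gt0// ltr_wpDl.
pose t := Num.min delta (e `^ (s - 1)^-1).
have t0 : 0 < t by rewrite lt_min d0 powR_gt0.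
have te : t `^ (s - 1) <= e.
  have -> : e = (e `^ (s - 1)^-1) `^ (s - 1).
    by rewrite -powRrM mulVf// powRr1// ltW.
  apply: ge0_ler_powR; rewrite ?nnegrE ?powR_ge0//; try exact: ltW.
  by rewrite /t ge_min lexx orbT.
have [m hm] := small t t0.
(* Cells cut out by [dyidx] are disjoint, so their masses add up to [M] even at shared endpoints;
   those with [i >= 2^m] are empty. *)
pose F i : set R := [set x | 0 <= x <= 1 /\ dyidx m x = i].
have FI i : is_interval (F i).
  move=> a b [/andP[a0 a1] ai] [/andP[b0 b1] bi] c /andP[ac cb].
  have c0 : 0 <= c by exact: le_trans ac.
  split; first by rewrite c0/= (le_trans cb).
  have mono (y z : R) : 0 <= y -> y <= z -> (dyidx m y <= dyidx m z)%N.
    move=> y0 yz; have z0 : 0 <= z by exact: le_trans yz.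
    have [yp|yp] := ltP 0 y; last by rewrite {1}/dyidx yp.
    have [_ /(_ yp) lt] := dyidx_itv m y0.
    have [/andP[_ le] _] := dyidx_itv m z0.
    rewrite -ltnS -(ltr_nat R) (lt_le_trans lt)// (le_trans _ le)//.
    by rewrite ler_pM2r// exprn_gt0.
  apply/eqP; rewrite eqn_leq -[X in (_ <= X)%N && _]bi.
  by rewrite -[X in _ && (X <= _)%N]ai !mono.
have mF i : measurable (F i) := is_interval_measurable (FI i).
have F01 i : F i `<=` `[0, 1]%classic by move=> x [] /=; rewrite in_itv.
have muF i : (mu (F i) <= t%:E)%E.
  have [[x [x01 xi]]|F0] := pselect (F i !=set0); last first.
    by rewrite (_ : F i = set0) ?measure0 ?lee_fin ?ltW//; apply/nonemptyPn.
  apply: le_trans (hm x x01); apply: le_measure; rewrite ?inE//.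
    exact: measurable_ball01.
  move=> y [y01 yi]; split; last by rewrite /= in_itv.
  have /andP[x0 _] := x01; have /andP[y0 _] := y01.
  have [/andP[l1 u1] _] := dyidx_itv m x0.
  have [/andP[l2 u2] _] := dyidx_itv m y0.
  rewrite xi in l1 u1; rewrite yi in l2 u2; rewrite -[i.+1%:R]natr1 in u1 u2.
  have p2 : 0 < 2 ^+ m :> R by rewrite exprn_gt0.
  have pi2 : 2 ^- m * 2 ^+ m = 1 :> R by rewrite mulVf// gt_eqF.
  rewrite /= in_itv/=; apply/andP; split.
    by rewrite -(ler_pM2r p2) mulrBl pi2; lra.
  by rewrite -(ler_pM2r p2) mulrDl pi2; lra.
have UF : \bigcup_i F i = `[0, 1]%classic.
  apply/seteqP; split => [x [i _ /F01]//|x /=].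
  by rewrite in_itv/= => x01; exists (dyidx m x).
have finF i : mu (F i) \is a fin_num.
  by rewrite ge0_fin_numE// (le_lt_trans (muF i)) ?ltry.
exists F; split.
- by rewrite UF.
- move=> i; split; first exact: F01.
  apply: (le_trans (diam_cascade_le mu (FI i))); apply: (le_trans (muF i)).
  by rewrite lee_fin ge_min lexx.
- apply: (@le_trans _ _ (\sum_(0 <= i <oo) e%:E * mu (F i))%E).
    apply: lee_nneseries => [i _ _|i _]; first exact: poweR_ge0.
    apply: (@le_trans _ _ (mu (F i) `^ s)%E).
      apply: gt0_ler_poweR; rewrite ?in_itv/= ?leey ?andbT ?diam_ge0//.
        by rewrite ltW// (lt_trans ltr01).
      exact: diam_cascade_le.
    have a0 : 0 <= fine (mu (F i)) by rewrite fine_ge0.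
    have at0 : fine (mu (F i)) <= t by rewrite -lee_fin fineK.
    have -> : mu (F i) = (fine (mu (F i)))%:E by rewrite fineK.
    move: (fine _) a0 at0 => a a0 at0; rewrite poweR_EFin -EFinM lee_fin.
    rewrite -(mulr_powRB1 a0 (lt_trans ltr01 s1)) mulrC.
    rewrite ler_wpM2r//; apply: le_trans te.
    by apply: ge0_ler_powR; rewrite ?nnegrE//; exact: ltW.
  rewrite nneseriesZl; last by [].
  rewrite -measure_semi_bigcup//; first last.
  + by rewrite UF.
  + by apply/trivIsetP => i j _ _ ij; apply/seteqP; split => // x [[_ xi] [_ xj]];
      move: ij; rewrite -xi -xj eqxx.
  rewrite UF ME -EFinM lee_fin /e mulrAC ler_pdivrMr ?ltr_wpDl//.
  by rewrite ler_wpM2l ?lerDl// ltW.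
Qed.

End hausdorff.

(** * Covers by balls of dyadic radius *)

Section euclidean_covers.
Context {R : realType}.

(** [m + 1] is the least exponent with [2^-(m + 1) < rho]. *)
Lemma dyadic_scale (rho : R) : 0 < rho <= 1 ->
  exists m, rho <= 2 ^- m /\ 2 ^- m <= 2 * rho.
Proof.
move=> /andP[rho0 rho1].
have ex : exists n, 2 ^- n < rho.
  exists (Num.bound rho^-1); rewrite invf_plt ?posrE ?exprn_gt0//.
  apply: (lt_trans (archi_boundP _)); first by rewrite invr_ge0 ltW.
  by rewrite -natrX ltr_nat ltn_expl.
case: (ex_minnP ex) => -[|n] hn minn.
  by move: hn; rewrite expr0 invr1 ltNge rho1.
exists n; split.
  by rewrite leNgt; apply/negP => /minn; rewrite ltnn.
by move: hn; rewrite exprS invfM => hn; rewrite ltW// -ltr_pdivrMl.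
Qed.

(** The error [e] is there for sets of diameter 0, which no positive radius matches: [r] is replaced
    by [max r z], with [z] so small that [(2 z)^t <= e]. *)
Lemma dyadic_scale_powR (r t e : R) : 0 <= r <= 1 -> 0 < t -> 0 < e ->
  exists m, r <= 2 ^- m /\ (2 ^- m) `^ t <= 2 `^ t * r `^ t + e.
Proof.
move=> /andP[r0 r1] t0 e0.
pose z := Num.min 1 (e `^ t^-1 / 2).
have z0 : 0 < z by rewrite lt_min ltr01 divr_gt0// powR_gt0.
have z1 : z <= 1 by rewrite /z ge_min lexx.
have [|m [h1 h2]] := @dyadic_scale (Num.max r z).
  by rewrite lt_max z0 orbT ge_max r1 z1.
exists m; split; first by apply: le_trans h1; rewrite le_max lexx.
apply: (@le_trans _ _ ((2 * Num.max r z) `^ t)).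
  apply: ge0_ler_powR => //; first exact: ltW.
    by rewrite nnegrE invr_ge0 exprn_ge0.
  by rewrite nnegrE mulr_ge0// le_max r0.
have [rz|zr] := leP r z; last by rewrite powRM// lerDl ltW.
apply: (@le_trans _ _ ((e `^ t^-1) `^ t)).
  apply: ge0_ler_powR => //; first exact: ltW.
  - by rewrite nnegrE mulr_ge0// ltW.
  - by rewrite nnegrE powR_ge0.
  - by rewrite mulrC -ler_pdivlMr// /z ge_min lexx orbT.
rewrite -powRrM mulVf ?gt_eqF// powRr1; last exact: ltW.
by rewrite lerDr mulr_ge0// powR_ge0.
Qed.

Lemma hmeasure_euclid_cover (K : set R) (t eps : R) :
  0 < t -> 0 < eps -> hmeasure `[0, 1] (@euclid R) t K = 0%E ->
  exists xm : nat -> R * nat,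
    [/\ forall i, 0 <= (xm i).1 <= 1,
        K `<=` \bigcup_i ball01 (xm i).2 (xm i).1 &
        (\sum_(0 <= i <oo) ((2 ^- (xm i).2) `^ t)%:E <= eps%:E)%E].
Proof.
move=> t0 eps0 H0.
(* Doubling the radii costs a factor [2^t], so the main terms sum to at most [eps / 2]; the errors
   [e i] below supply the other half. *)
pose eta := eps / 2 / 2 `^ t.
have p2 : 0 < (2 : R) `^ t by rewrite powR_gt0.
have eta0 : 0 < eta by rewrite !divr_gt0.
have [F [KF FA Feta]] := hmeasure_eq0_cover H0 ltr01 eta0.
pose e i : R := (eps / 2) / (2 ^ i.+1)%:R.
have e0 i : 0 < e i by rewrite !divr_gt0// ltr0n expn_gt0.
have finD i : diam (@euclid R) (F i) \is a fin_num.
  by rewrite ge0_fin_numE ?diam_ge0// (le_lt_trans (FA i).2) ?ltry.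
pose D i := fine (diam (@euclid R) (F i)).
have DE i : diam (@euclid R) (F i) = (D i)%:E by rewrite fineK.
have D0 i : 0 <= D i by rewrite fine_ge0 ?diam_ge0.
have D1 i : D i <= 1 by rewrite -lee_fin -DE; exact: (FA i).2.
have ex i : exists xm : R * nat, [/\ 0 <= xm.1 <= 1,
    F i `<=` ball01 xm.2 xm.1 & (2 ^- xm.2) `^ t <= 2 `^ t * D i `^ t + e i].
  have [|m [Dm me]] := @dyadic_scale_powR (D i) t (e i) _ t0 (e0 i).
    by rewrite D0 D1.
  have [[x Fx]|F0] := pselect (F i !=set0); last first.
    exists (0, m); split => //=; first by rewrite lexx ler01.
    by move/nonemptyPn : F0 => ->.
  have x01 : 0 <= x <= 1 by have := (FA i).1 x Fx; rewrite /= in_itv.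
  exists (x, m); split => //= y Fy; split; last exact: (FA i).1.
  have : `|y - x| <= 2 ^- m.
    apply: le_trans Dm; rewrite -lee_fin -DE.
    by apply: ereal_sup_ubound; right; exists y => //; exists x.
  by rewrite ler_norml /= in_itv/= => /andP[h1 h2]; apply/andP; split; lra.
have [xm xmP] := choice ex; exists xm; split.
- by move=> i; have [] := xmP i.
- by move=> x /KF[i _ Fx]; exists i => //; have [_ + _] := xmP i; apply.
- apply: (@le_trans _ _ (\sum_(0 <= i <oo) ((2 `^ t * D i `^ t)%:E + (e i)%:E))%E).
    apply: lee_nneseries => [i _ _|i _]; first by rewrite lee_fin powR_ge0.
    by rewrite -EFinD lee_fin; have [] := xmP i.
  apply: (@le_trans _ _ (\sum_(0 <= i <oo) (2 `^ t * D i `^ t)%:E + (eps / 2)%:E)%E).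
    apply: epsilon_trick; last by rewrite divr_ge0// ltW.
    by move=> i; rewrite lee_fin mulr_ge0 ?powR_ge0.
  under eq_eseriesr => i _ do rewrite EFinM -(poweR_EFin (D i)) -DE.
  rewrite nneseriesZl; last by move=> i _; exact: poweR_ge0.
  have -> : eps%:E = ((2 `^ t)%:E * eta%:E + (eps / 2)%:E)%E.
    rewrite -EFinM -EFinD /eta; congr EFin; field.
    by rewrite gt_eqF.
  by rewrite leeD2r// lee_wpmul2l// lee_fin powR_ge0.
Qed.

End euclidean_covers.

(** Two terms suffice: a ratio [z / (x + y)] in [[0, 1]] is at most its [s]-th power, and the ratios
    of [x] and [y] add up to 1. *)
Lemma powR_sum_le {R : realType} (I : Type) (l : seq I) (a : I -> R) (s : R) :
  0 < s <= 1 -> (forall i, 0 <= a i) ->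
  (\sum_(i <- l) a i) `^ s <= \sum_(i <- l) a i `^ s.
Proof.
move=> /andP[s0 s1] a0.
have add (x y : R) : 0 <= x -> 0 <= y -> (x + y) `^ s <= x `^ s + y `^ s.
  move=> x0 y0; have [xy|xy] := eqVneq (x + y) 0.
    by rewrite xy powR0 ?gt_eqF// addr_ge0// powR_ge0.
  have xy0 : 0 < x + y by rewrite lt_neqAle eq_sym xy addr_ge0.
  have part z : 0 <= z -> z <= x + y -> z / (x + y) * (x + y) `^ s <= z `^ s.
    move=> z0 zle; have [->|zn] := eqVneq z 0; first by rewrite !mul0r powR_ge0.
    have zp : 0 < z by rewrite lt_neqAle eq_sym zn.
    rewrite -[X in _ <= X `^ s](divfK xy) powRM//; [|by rewrite divr_ge0// ltW|exact: ltW].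
    apply: ler_wpM2r; first exact: powR_ge0.
    by apply: ger1_powR => //; rewrite divr_gt0//= ler_pdivrMr// mul1r.
  have hx := part x x0; have hy := part y y0.
  apply: le_trans (lerD (hx _) (hy _)); rewrite ?lerDl ?lerDr//.
  by rewrite -mulrDl -mulrDl divff// mul1r.
elim: l => [|i l ih]; first by rewrite !big_nil powR0// gt_eqF.
rewrite !big_cons; apply: le_trans (add _ _ _ _) _ => //.
  by apply: sumr_ge0.
by rewrite lerD2l.
Qed.

Lemma einfs_le_limn_einf {R : realType} (u : nat -> \bar R) n :
  (einfs u n <= limn_einf u)%E.
Proof.
rewrite limn_einf_lim.
have /cvg_lim -> // := ereal_nondecreasing_cvgn (@nondecreasing_einfs R u).
by apply: ereal_sup_ubound; exists n.
Qed.

Lemma limn_einf_le {R : realType} (u : nat -> \bar R) (c : \bar R) :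
  (forall n, (u n <= c)%E) -> (limn_einf u <= c)%E.
Proof.
move=> uc; rewrite limn_einf_lim.
have /cvg_lim -> // := ereal_nondecreasing_cvgn (@nondecreasing_einfs R u).
apply: ge_ereal_sup => _ [n _ <-]; apply: ge_ereal_inf; exists (u n) => //.
by exists n => /=.
Qed.

Lemma limn_einf_lt {R : realType} (u : nat -> \bar R) (c : \bar R) :
  (limn_einf u < c)%E -> forall n, exists2 k, (n <= k)%N & (u k < c)%E.
Proof.
move=> uc n; have := le_lt_trans (einfs_le_limn_einf u n) uc.
by move=> /ereal_inf_lt[_ [k /= nk <-] uk]; exists k.
Qed.

Lemma measurable_fun_limn_einf {d : measure_display} {T : measurableType d}
    {R : realType} (f : nat -> T -> \bar R) :
  (forall n, measurable_fun setT (f n)) ->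
  measurable_fun setT (fun x => limn_einf (f ^~ x)).
Proof.
move=> mf; apply: (emeasurable_fun_cvg (fun n x => einfs (f ^~ x) n)).
  by move=> n; exact: measurable_fun_einfs.
move=> x _; rewrite limn_einf_lim; exact: is_cvg_einfs.
Qed.

(** * Moment bounds for the mass of a small ball *)

Section balls.
Context {d : measure_display} {T : measurableType d} {R : realType}.
Variables (W : nat * nat -> T -> R).

Definition nearby_mass (m : nat) (x : R) (r : nat) (om : T) : R :=
  \sum_(v <- nearby m x) cmass v r (tree_env W om).

(* By Fatou's lemma its expectation controls that of [mu (ball01 m x) `^ s],
   which need not itself be a measurable function of [om]. *)
Definition ball_power (s : R) (m : nat) (x : R) (om : T) : \bar R :=
  limn_einf (fun r => (nearby_mass m x r om `^ s)%:E).

Lemma nearby_mass_ge0 m x r om : 0 <= nearby_mass m x r om.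
Proof. by apply: sumr_ge0 => v _; exact: cmass_ge0. Qed.

Lemma ball_power_ge0 s m x om : (0 <= ball_power s m x om)%E.
Proof.
apply: le_trans (einfs_le_limn_einf _ 0).
by apply: le_ereal_inf_tmp => _ [k _ <-]; rewrite lee_fin powR_ge0.
Qed.

(** Otherwise some [c] lies strictly between the lower limit and [mu(ball)^s]. Then [nearby_mass] is
    at most [c^(1/s)] for infinitely many [r], and so is the mass of the ball by
    [weak_limit_ball_le]. *)
Lemma cascade_ball_power om (mu : {measure set R -> \bar R}) (s : R) m (x : R) :
  (forall nk, dyadic_index nk -> 0 <= W nk om) ->
  weak_limit_cascade W om mu -> 0 < s -> 0 <= x <= 1 ->
  (mu (ball01 m x) `^ s <= ball_power s m x om)%E.
Proof.
move=> W0 wl s0 x01; rewrite leNgt; apply/negP => lt.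
have muoo : mu (ball01 m x) \is a fin_num.
  rewrite ge0_fin_numE//; apply: le_lt_trans wl.1.
  by apply: le_measure; rewrite ?inE//; [exact: measurable_ball01|move=> y []].
have vE : mu (ball01 m x) = (fine (mu (ball01 m x)))%:E by rewrite fineK.
have : 0 <= fine (mu (ball01 m x)) by rewrite fine_ge0.
move: vE; move: (fine _) => v vE v0.
move: lt; rewrite vE poweR_EFin.
have := ball_power_ge0 s m x om.
case lE : (ball_power s m x om) => [l| |]//; rewrite lee_fin lte_fin => l0 lv.
pose c := (l + v `^ s) / 2.
have lc : l < c by exact: (midf_lt lv).1.
have cv : c < v `^ s by exact: (midf_lt lv).2.
have c0 : 0 <= c by rewrite (le_trans l0)// ltW.
have fr : (ball_power s m x om < c%:E)%E by rewrite lE lte_fin.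
have : (mu (ball01 m x) <= (c `^ s^-1)%:E)%E.
  apply: (weak_limit_ball_le W0 wl x01) => r0.
  have [r r0r] := limn_einf_lt fr r0; rewrite lte_fin => /ltW hr.
  exists r => //; rewrite -/(nearby_mass m x r om).
  have n0 := nearby_mass_ge0 m x r om.
  rewrite -[leLHS]powRr1// -(mulfV (lt0r_neq0 s0)) powRrM.
  by apply: ge0_ler_powR; rewrite ?nnegrE ?powR_ge0// invr_ge0 ltW.
rewrite vE lee_fin => vc.
have : v `^ s <= c.
  rewrite -[leRHS]powRr1// -(mulVf (lt0r_neq0 s0)) powRrM.
  by apply: ge0_ler_powR; rewrite ?nnegrE ?powR_ge0// ltW.
by rewrite leNgt cv.
Qed.

Variables (P : probability T R) (X : T -> R).
Hypothesis mX : measurable_fun setT X.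
Hypothesis EX : (\int[P]_om (`|X om|)%:E = 1)%E.
Hypothesis iW : iid P X (fun u => W (node u)).

Lemma measurable_nearby_mass m x r : measurable_fun setT (nearby_mass m x r).
Proof.
rewrite /nearby_mass; apply: measurable_sum => v.
exact: (measurable_cmass v r iW.1).
Qed.

Lemma measurable_ball_power s m x : measurable_fun setT (ball_power s m x).
Proof.
apply: measurable_fun_limn_einf => r; apply/measurable_EFinP.
exact/measurable_fun_powR/measurable_nearby_mass.
Qed.

(** Fatou's lemma, subadditivity over at most 5 nearby intervals, and [expectation_cmass] for each.
    When [b] is the [s]-th moment of [|X|], the condition on [t] says [t <= phi(s)]. *)
Lemma expectation_ball_power (s t b : R) m x : 0 < s <= 1 -> 0 <= b ->
  (\int[P]_om (`|X om| `^ s)%:E <= b%:E)%E -> 2 `^ (- s) * b <= 2 `^ (- t) ->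
  (\int[P]_om ball_power s m x om <= (5 * (2 ^- m) `^ t)%:E)%E.
Proof.
move=> s01 b0 Xb bt.
have mn r : measurable_fun setT (fun om => (nearby_mass m x r om `^ s)%:E).
  exact/measurable_EFinP/measurable_fun_powR/measurable_nearby_mass.
apply: le_trans (fatou P measurableT mn _) _.
  by move=> r om _; rewrite lee_fin powR_ge0.
have bnd r : (\int[P]_om (nearby_mass m x r om `^ s)%:E <= (5 * (2 ^- m) `^ t)%:E)%E.
  apply: (@le_trans _ _ (\int[P]_om (\sum_(v <- nearby m x)
      (cmass v r (tree_env W om) `^ s)%:E))%E).
    apply: ge0_integral_mono => om _; first by rewrite lee_fin powR_ge0.
    rewrite sumEFin lee_fin; apply: powR_sum_le => // v; exact: cmass_ge0.
  rewrite ge0_integral_sum//; last first.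
    by move=> v om _; rewrite lee_fin powR_ge0.
    move=> v; apply/measurable_EFinP/measurable_fun_powR.
    exact: (measurable_cmass v r iW.1).
  have p0 : 0 <= (2 ^- m : R) `^ t by rewrite powR_ge0.
  apply: (@le_trans _ _ (\sum_(v <- nearby m x) ((2 ^- m) `^ t)%:E)%E).
    rewrite big_seq [leRHS]big_seq; apply: lee_sum => v.
    rewrite mem_filter mem_words => /andP[_ /eqP vm].
    apply: le_trans (expectation_cmass mX EX v r s01 b0 Xb iW) _.
    rewrite vm lee_fin; apply: (@le_trans _ _ ((2 `^ (- t)) ^+ m)).
      by apply: lerXn2r; rewrite ?nnegrE ?powR_ge0// mulr_ge0// powR_ge0.
    rewrite -powR_mulrn ?powR_ge0// -powRrM -[2 ^- m]powR_invn// -powRrM.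
    by rewrite !mulNr mulrC.
  rewrite sumEFin lee_fin big_const_seq count_predT iter_addr_0 -[leLHS]mulr_natl.
  by rewrite ler_wpM2r// ler_nat size_nearby.
exact: limn_einf_le.
Qed.

End balls.

(** * Almost sure bounds *)

Section almost_sure.
Context {d : measure_display} {T : measurableType d} {R : realType}.
Variable P : probability T R.

(** The infimum over [q] is nonnegative with expectation at most [C / (q + 1)] for every [q], so it
    vanishes almost surely. *)
Lemma ae_inf_small (f : nat -> T -> \bar R) (C : R) :
  (forall q, measurable_fun setT (f q)) -> (forall q om, (0 <= f q om)%E) ->
  (forall q, (\int[P]_om f q om <= (C / q.+1%:R)%:E)%E) ->
  {ae P, forall om, forall eta : R, 0 < eta -> exists q, (f q om < eta%:E)%E}.
Proof.
move=> mf f0 fC.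
pose g om := einfs (f ^~ om) 0.
have g0 om : (0 <= g om)%E by apply: le_ereal_inf_tmp => _ [k _ <-].
have mg : measurable_fun setT g by exact: measurable_fun_einfs.
have C0 : 0 <= C.
  have /le_trans/(_ (fC 0%N)) : (0 <= \int[P]_om f 0%N om)%E by exact: integral_ge0.
  by rewrite lee_fin divr1.
have Ig : (\int[P]_om `|g om| = 0)%E.
  under eq_integral do rewrite gee0_abs//.
  apply/eqP; rewrite eq_le integral_ge0// andbT.
  have le q : (\int[P]_om g om <= (C / q.+1%:R)%:E)%E.
    apply: le_trans (fC q); apply: ge0_integral_mono => // om _.
    by apply: ge_ereal_inf; exists (f q om) => //; exists q.
  apply/lee_addgt0Pr => e e0; rewrite add0e.
  apply: (le_trans (le (Num.bound (C / e)))); rewrite lee_fin ler_pdivrMr//.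
  rewrite mulrC -ler_pdivrMr// ltW// (lt_trans (archi_boundP _))//.
    by rewrite divr_ge0// ltW.
  by rewrite ltr_nat.
have := (ae_eq_integral_abs P measurableT mg).1 Ig.
apply: filterS => om /(_ I) gom eta eta0.
have : (g om < eta%:E)%E by rewrite gom lte_fin.
by move=> /ereal_inf_lt[_ [q _ <-] h]; exists q.
Qed.

Variables (X : T -> R) (W : nat * nat -> T -> R).
Variable mu : T -> {measure set R -> \bar R}.
Hypothesis mX : measurable_fun setT X.
Hypothesis EX : (\int[P]_om (`|X om|)%:E = 1)%E.
Hypothesis iW : iid P X (fun u => W (node u)).
Hypothesis W0 : {ae P, forall om, forall nk, dyadic_index nk -> 0 <= W nk om}.
Hypothesis wl : {ae P, forall om, weak_limit_cascade W om (mu om)}.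

(** Since [K] is deterministic, the Euclidean covers are fixed before [om]. The [q]-th one has
    expected sum at most [5 / (q + 1)], so almost surely some of them have arbitrarily small
    sums. *)
Lemma ae_hmeasure_cascade (K : set R) (s t b : R) : 0 < s <= 1 -> 0 < t ->
  0 <= b -> (\int[P]_om (`|X om| `^ s)%:E <= b%:E)%E ->
  2 `^ (- s) * b <= 2 `^ (- t) -> hmeasure `[0, 1] (@euclid R) t K = 0%E ->
  {ae P, forall om, hmeasure `[0, 1] (cascade_metric (mu om)) s K = 0%E}.
Proof.
move=> s01 t0 b0 Xb bt H0; have /andP[s0 s1] := s01.
have cover q : exists xm : nat -> R * nat,
    [/\ forall i, 0 <= (xm i).1 <= 1,
        K `<=` \bigcup_i ball01 (xm i).2 (xm i).1 &
        (\sum_(0 <= i <oo) ((2 ^- (xm i).2) `^ t)%:E <= (q.+1%:R^-1)%:E)%E].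
  by apply: hmeasure_euclid_cover => //; rewrite invr_gt0.
have [xm xmP] := choice cover.
pose f q om := (\sum_(0 <= i <oo) ball_power W s (xm q i).2 (xm q i).1 om)%E.
have mb q i : measurable_fun setT (ball_power W s (xm q i).2 (xm q i).1).
  exact: (measurable_ball_power iW).
have b0' q i om : (0 <= ball_power W s (xm q i).2 (xm q i).1 om)%E.
  exact: ball_power_ge0.
have fC q : (\int[P]_om f q om <= (5 / q.+1%:R)%:E)%E.
  rewrite integral_nneseries//.
  apply: (@le_trans _ _ (\sum_(0 <= i <oo) 5%:E * ((2 ^- (xm q i).2) `^ t)%:E)%E).
    apply: lee_nneseries => [i _ _|i _]; first exact: integral_ge0.
    by rewrite -EFinM; exact: (expectation_ball_power mX EX iW _ _ s01 b0 Xb bt).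
  rewrite nneseriesZl; last by move=> i _; rewrite lee_fin powR_ge0.
  rewrite EFinM; apply: lee_wpmul2l; first by rewrite lee_fin.
  by have [] := xmP q.
have mf q : measurable_fun setT (f q).
  rewrite /f; apply: (ge0_emeasurable_sum (P := xpredT)) => // i _; exact: mb.
have f0 q om : (0 <= f q om)%E by exact: nneseries_ge0.
have small := ae_inf_small mf f0 fC.
apply: filterS3 small W0 wl => om small W0om wlom.
apply: hmeasure_eq0 => delta eta d0 eta0.
(* Each term is at most the whole sum, so a sum below [delta^s] also keeps every diameter below
   [delta]. *)
pose eta' := Num.min eta (delta `^ s).
have eta'0 : 0 < eta' by rewrite lt_min eta0 powR_gt0.
have [q fq] := small eta' eta'0.
have [x01 Kc _] := xmP q.
have diamP i : (diam (cascade_metric (mu om)) (ball01 (xm q i).2 (xm q i).1) `^ s <=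
    ball_power W s (xm q i).2 (xm q i).1 om)%E.
  apply: (le_trans _ (cascade_ball_power _ W0om wlom s0 (x01 i))).
  apply: gt0_ler_poweR; rewrite ?in_itv/= ?leey ?andbT ?diam_ge0//; first exact: ltW.
  by apply: diam_cascade_le; exact: is_interval_ball01.
exists (fun i => ball01 (xm q i).2 (xm q i).1); split => //.
- move=> i; split; first by move=> y [].
  have term : (ball_power W s (xm q i).2 (xm q i).1 om <= f q om)%E.
    apply: (@le_trans _ _ (\sum_(0 <= j < i.+1) ball_power W s (xm q j).2 (xm q j).1 om)%E).
      by rewrite big_nat_recr//= leeDr// sume_ge0.
    exact: nneseries_lim_ge.
  have : (diam (cascade_metric (mu om)) (ball01 (xm q i).2 (xm q i).1) `^ s <=
      delta%:E `^ s)%E.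
    apply: le_trans (diamP i) _; apply: le_trans term _; apply: le_trans (ltW fq) _.
    by rewrite poweR_EFin lee_fin ge_min lexx orbT.
  have inv (y : \bar R) : (0 <= y)%E -> y = ((y `^ s) `^ s^-1)%E.
    by move=> y0; rewrite -poweRrM mulfV ?gt_eqF// poweRe1.
  move=> le; rewrite [leLHS](inv _ (diam_ge0 _ _)) [leRHS]inv; last exact: ltW.
  apply: gt0_ler_poweR le; rewrite ?in_itv/= ?leey ?andbT ?poweR_ge0//.
    by rewrite invr_ge0 ltW.
  by rewrite lee_fin powR_ge0.
- apply: (@le_trans _ _ (f q om)).
    by apply: lee_nneseries => [i _ _|i _]; [exact: poweR_ge0|exact: diamP].
  by apply: le_trans (ltW fq) _; rewrite lee_fin ge_min lexx.
Qed.

Lemma ae_hmeasure_cascade_gt1 (K : set R) : K `<=` `[0, 1] ->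
  {ae P, forall om, forall s, 1 < s ->
    hmeasure `[0, 1] (cascade_metric (mu om)) s K = 0%E}.
Proof.
move=> K01; apply: filterS3 (ae_small_cells mX EX iW) W0 wl => om small W0om wlom s s1.
apply: hmeasure_cascade_gt1 => //; first exact: wlom.1.
(* At most 5 intervals are near [x], each of mass at most [t / 5]. *)
move=> t t0; have [|m hm] := small (t / 5); first by rewrite divr_gt0.
exists m => x x01; apply: (weak_limit_ball_le W0om wlom x01) => r0.
have [r r0r hr] := hm r0; exists r => //.
have {}hr : maxmass m r (tree_env W om) <= t / 5 by [].
apply: (@le_trans _ _ (\sum_(v <- nearby m x) t / 5)).
  rewrite big_seq [leRHS]big_seq; apply: ler_sum => v.
  rewrite mem_filter mem_words => /andP[_ /eqP vm].
  by apply: le_trans hr; rewrite -vm; exact: cmass_le_maxmass.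
rewrite big_const_seq count_predT iter_addr_0 -[leLHS]mulr_natr.
rewrite -[leRHS](divfK (_ : 5 != 0 :> R))// ler_wpM2l//; first by rewrite divr_ge0// ltW.
by rewrite ler_nat size_nearby.
Qed.

End almost_sure.

(** * Moments of the weight *)

Section moments.
Context {d : measure_display} {T : measurableType d} {R : realType}.
Variables (P : probability T R) (X : T -> R).
Hypothesis mX : measurable_fun setT X.
Hypothesis EX : (\int[P]_om (`|X om|)%:E = 1)%E.

(* Meaningful only when the integral is finite, e.g. for [0 < s <= 1]. *)
Definition moment (s : R) : R := fine (\int[P]_om (`|X om| `^ s)%:E)%E.

Let mXs s : measurable_fun setT (fun om => (`|X om| `^ s)%:E).
Proof. by apply/measurable_EFinP/measurable_fun_powR; exact: measurableT_comp. Qed.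

Lemma ge0_integral_affine (f : T -> R) (a c : R) : measurable_fun setT f ->
  (forall om, 0 <= f om) -> 0 <= a -> 0 <= c ->
  (\int[P]_om (a * f om + c)%:E = a%:E * \int[P]_om (f om)%:E + c%:E)%E.
Proof.
move=> mf f0 a0 c0; have mf' : measurable_fun setT (fun om => (f om)%:E).
  exact/measurable_EFinP.
have h1 om : setT om -> (0 <= a%:E * (f om)%:E)%E.
  by move=> _; rewrite -EFinM lee_fin mulr_ge0.
have h2 : measurable_fun setT (fun om => a%:E * (f om)%:E)%E by exact: emeasurable_funM.
under eq_integral do rewrite EFinD EFinM.
have h3 om : setT om -> (0 <= (f om)%:E)%E by move=> _; rewrite lee_fin.
have h4 : (0 <= a%:E)%E by rewrite lee_fin.
have h5 om : setT om -> (0 <= c%:E :> \bar R)%E by move=> _; rewrite lee_fin.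
rewrite ge0_integralD// ge0_integralZl//.
have -> : (\int[P]_om c%:E = c%:E)%E; last by [].
rewrite integral_cst// -[RHS]mule1; congr (_ * _)%E; exact: probability_setT.
Qed.

(** Finite by the affine bound; positive because a vanishing moment would force [|X| = 0] almost
    surely, against mean 1. *)
Lemma moment_bounds s : 0 < s <= 1 ->
  (\int[P]_om (`|X om| `^ s)%:E = (moment s)%:E)%E /\ 0 < moment s.
Proof.
move=> s01; have /andP[s0 s1] := s01.
have fin : (\int[P]_om (`|X om| `^ s)%:E)%E \is a fin_num.
  rewrite ge0_fin_numE; last by apply: integral_ge0 => om _; rewrite lee_fin powR_ge0.
  apply: (@le_lt_trans _ _ (\int[P]_om (s * `|X om| + (1 - s))%:E)%E).
    apply: ge0_integral_mono => om _; rewrite lee_fin ?powR_ge0//.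
    exact: powR_le_affine.
  rewrite ge0_integral_affine ?subr_ge0//; last 2 first.
  - exact: measurableT_comp.
  - exact: ltW.
  by rewrite EX mule1 -EFinD ltry.
split; first by rewrite fineK.
rewrite lt_neqAle fine_ge0 ?andbT; last first.
  by apply: integral_ge0 => om _; rewrite lee_fin powR_ge0.
apply/eqP => m0.
have I0 : (\int[P]_om `|(`|X om| `^ s)%:E| = 0)%E.
  under eq_integral do rewrite gee0_abs ?lee_fin ?powR_ge0//.
  by rewrite -(fineK fin) -/(moment s) -m0.
have /(ae_eq_integral_abs P measurableT (mXs s)) h := I0.
have I1 : (\int[P]_om `|(`|X om|)%:E| = 0)%E.
  apply/ae_eq_integral_abs => //; first by apply/measurable_EFinP; exact: measurableT_comp.
  apply: filterS h => om /[apply] /= -[] /powR_eq0_eq0 ->.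
  by [].
have : (\int[P]_om (`|X om|)%:E = 0)%E.
  by rewrite -[RHS]I1; apply: eq_integral => om _; rewrite gee0_abs.
by rewrite EX => /eqP; rewrite eqe oner_eq0.
Qed.

(* Jensen's inequality for the concave power [s / z]. *)
Lemma moment_le s z : 0 < s -> s <= z -> z <= 1 ->
  moment s <= moment z `^ (s / z).
Proof.
move=> s0 sz z1; have z0 : 0 < z by exact: lt_le_trans sz.
have [Es ms0] := @moment_bounds s ltac:(by rewrite s0 (le_trans sz)).
have [Ez mz0] := @moment_bounds z ltac:(by rewrite z0 z1).
set c := moment z in mz0 Ez *; pose th := s / z.
have th0 : 0 < th by rewrite divr_gt0.
have th1 : th <= 1 by rewrite ler_pdivrMr// mul1r.
have cth0 : 0 < c `^ th by rewrite powR_gt0.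
rewrite -/th -lee_fin -Es.
(* [powR_le_affine] with exponent [th], applied to [|X|^z / c]; as this variable has mean 1, the
   affine bound integrates to exactly [c^th]. *)
apply: (@le_trans _ _ (\int[P]_om (c `^ th * (th / c) * `|X om| `^ z + c `^ th * (1 - th))%:E)%E).
  apply: ge0_integral_mono => om _; rewrite lee_fin ?powR_ge0//.
  have y0 : 0 <= `|X om| `^ z by exact: powR_ge0.
  have -> : `|X om| `^ s = (c * (`|X om| `^ z / c)) `^ th.
    by rewrite mulrCA mulfV ?gt_eqF// mulr1 -powRrM /th mulrCA mulfV ?gt_eqF// mulr1.
  rewrite powRM; [|exact: ltW|by rewrite divr_ge0// ltW].
  apply: (@le_trans _ _ (c `^ th * (th * (`|X om| `^ z / c) + (1 - th)))).
    rewrite ler_wpM2l ?powR_ge0// powR_le_affine ?th0 ?th1//.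
    by rewrite divr_ge0// ltW.
  by rewrite le_eqVlt; apply/orP; left; apply/eqP; ring.
rewrite ge0_integral_affine; last 4 first.
- by apply: measurable_fun_powR; exact: measurableT_comp.
- by move=> om; exact: powR_ge0.
- by rewrite mulr_ge0 ?powR_ge0// divr_ge0// ltW.
- by rewrite mulr_ge0 ?powR_ge0// subr_ge0.
rewrite Ez -EFinM -EFinD lee_fin le_eqVlt; apply/orP; left; apply/eqP.
by field; rewrite gt_eqF.
Qed.

End moments.

(** * From almost sure bounds to the dimension inequality *)

Lemma iid_node {d : measure_display} {T : measurableType d} {R : realType}
    (P : probability T R) (X : {RV P >-> R}) (W : nat * nat -> {RV P >-> R}) :
  (forall nk, dyadic_index nk -> same_law P (W nk) X) ->
  mutually_independent P dyadic_index (fun nk => (W nk : T -> R)) ->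
  iid P X (fun u => W (node u)).
Proof.
move=> law ind; split => [u|s B us mB]; first exact: measurable_funP.
(* [B] is carried from addresses to nodes: on the nodes of [s], the position in the list inverts the
   injection [node]. *)
pose B' nk := B (nth [::] s (index nk (map node s))).
have := ind (map node s) B'; rewrite !big_map.
rewrite (map_inj_uniq node_inj) us all_map => h.
have BE u : u \in s -> B' (node u) = B u.
  by move=> us'; rewrite /B' (index_map node_inj) nth_index.
have : P (\big[setI/setT]_(u <- s) (W (node u) @^-1` B' (node u))) =
  (\prod_(u <- s) P (W (node u) @^-1` B' (node u)))%E.
  apply: h => [//||nk]; last exact: mB.
  by apply/allP => u _; exact: node_dyadic.
rewrite big_seq [in RHS]big_seq.
under eq_bigr => u us' do rewrite (BE _ us').
under [in RHS]eq_bigr => u us' do rewrite (BE _ us') (law _ (node_dyadic u) _ (mB u)).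
by rewrite -!big_seq.
Qed.

Lemma ae_forall_countable {d : measure_display} {T : measurableType d}
    {R : realType} (P : probability T R) (I : countType) (Q : I -> T -> Prop) :
  (forall i, {ae P, forall om, Q i om}) -> {ae P, forall om, forall i, Q i om}.
Proof.
move=> h; have h' n : {ae P, forall om, if unpickle n is Some i then Q i om else True}.
  by case: (unpickle n) => [i|]; [exact: h|apply: filterE].
have := ae_foralln h'; apply: filterS => om /= hom i.
by have := hom (pickle i); rewrite pickleK.
Qed.

Lemma hdim_ge0 {R : realType} (A : set R) rho (K : set R) : (0 <= hdim A rho K)%E.
Proof. by apply: le_ereal_inf_tmp => _ [s [s0 _] <-]; rewrite lee_fin ltW. Qed.

Lemma hdim_le {R : realType} (A : set R) rho (K : set R) (s : R) :
  0 < s -> hmeasure A rho s K = 0%E -> (hdim A rho K <= s%:E)%E.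
Proof. by move=> s0 H0; apply: ereal_inf_lbound; exists s. Qed.

Theorem theorem3p4 (d : measure_display) (T : measurableType d) (R : realType)
  (P : probability T R) (X : {RV P >-> R})
  (W : nat * nat -> {RV P >-> R})
  (mu : T -> {measure set R -> \bar R}) (K : set R) :
  P [set om | 0 < X om] = 1%E ->
  ('E_P[X])%E = 1%E ->
  (\int[P]_om (X om * log2 (X om))%:E < 1)%E ->
  (forall nk, dyadic_index nk -> same_law P (W nk) X) ->
  mutually_independent P dyadic_index (fun nk => (W nk : T -> R)) ->
  {ae P, forall om, weak_limit_cascade (fun nk => (W nk : T -> R)) om (mu om)} ->
  K `<=` `[0, 1] -> K !=set0 ->
  {ae P, forall om, exists zeta : R,
     hdim `[0%R, 1%R] (cascade_metric (mu om)) K = zeta%:E /\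
     (cascade_phi P X zeta <= hdim `[0%R, 1%R] (@euclid R) K)%E}.
Proof.
move=> PX0 EX1 _ law ind wl K01 _.
have mX : measurable_fun setT X by exact: measurable_funP.
have iW := iid_node law ind.
have posE (Y : {RV P >-> R}) : [set om | 0 < Y om] = Y @^-1` `]0, +oo[%classic.
  by apply/seteqP; split => om /=; rewrite in_itv/= andbT.
have mpos (Y : {RV P >-> R}) : measurable [set om | 0 < Y om].
  by rewrite posE -[X in measurable X]setTI; exact: measurable_funP.
have ae_pos (Y : {RV P >-> R}) : P [set om | 0 < Y om] = 1%E ->
    {ae P, forall om, 0 < Y om}.
  move=> PY; exists (~` [set om | 0 < Y om]); split => //.
    exact: measurableC.
  by rewrite probability_setC// PY subee.
have W0 : {ae P, forall om, forall nk, dyadic_index nk -> 0 <= W nk om}.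
  apply: ae_forall_countable => nk.
  have [dnk|ndnk] := boolP (dyadic_index nk); last by apply: filterE.
  have : P [set om | 0 < W nk om] = 1%E.
    by rewrite posE (law _ dnk)// -posE.
  by move=> /ae_pos; apply: filterS => om /ltW.
(* The tree masses use [|X|] and [phi] uses [X]; almost sure positivity identifies their moments. *)
have ae_abs : {ae P, forall om, `|X om| = X om}.
  by have := ae_pos _ PX0; apply: filterS => om /gtr0_norm.
have EX : (\int[P]_om (`|X om|)%:E = 1)%E.
  rewrite -EX1 unlock; apply: ae_eq_integral => //.
  - by apply/measurable_EFinP; exact: measurableT_comp.
  - exact/measurable_EFinP.
  - by apply: filterS ae_abs => om /= -> _.
have EXs s : (\int[P]_om (X om `^ s)%:E = \int[P]_om (`|X om| `^ s)%:E)%E.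
  apply: ae_eq_integral => //.
  - by apply/measurable_EFinP/measurable_fun_powR.
  - by apply/measurable_EFinP/measurable_fun_powR; exact: measurableT_comp.
  - by apply: filterS ae_abs => om /= -> _.
(* The dimension [zeta] depends on [om], so one null set must serve all exponents; rational ones
   suffice. *)
have small : {ae P, forall om, forall q : rat, forall t : R,
    0 < (ratr q : R) <= 1 -> 0 < t ->
    2 `^ (- ratr q) * moment P X (ratr q) <= 2 `^ (- t) ->
    hmeasure `[0, 1] (@euclid R) t K = 0%E ->
    hmeasure `[0, 1] (cascade_metric (mu om)) (ratr q) K = 0%E}.
  apply: ae_forall_countable => q.
  (* The conclusion does not involve [t], so for each [q] a single admissible [t] serves for all of
     them. *)
  have [[t [q01 t0 qt Ht]]|no] := pselect (exists t : R, [/\ 0 < (ratr q : R) <= 1, 0 < t,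
    2 `^ (- ratr q) * moment P X (ratr q) <= 2 `^ (- t) &
    hmeasure `[0, 1] (@euclid R) t K = 0%E]); last first.
    by apply: filterE => om t q01 t0 qt Ht; exfalso; apply: no; exists t.
  have [Eq mq0] := moment_bounds mX EX q01.
  have := ae_hmeasure_cascade mX EX iW W0 wl q01 t0 (ltW mq0) _ qt Ht.
  by rewrite Eq lexx => /(_ isT); apply: filterS.
have := ae_hmeasure_cascade_gt1 mX EX iW W0 wl K01.
apply: filterS2 small => om small gt1.
set D := hdim _ _ K.
(* The measure vanishes at every exponent [1 + e]; thus [zeta <= 1], and the moment bounds apply to
   it. *)
have D1 : (D <= 1%:E)%E.
  apply/lee_addgt0Pr => e e0; rewrite -EFinD; apply: hdim_le.
    by rewrite addr_gt0.
  by apply: gt1; rewrite ltrDl.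
have D0 : (0 <= D)%E by exact: hdim_ge0.
have Dfin : D \is a fin_num by rewrite ge0_fin_numE// (le_lt_trans D1) ?ltry.
exists (fine D); split; first by rewrite fineK.
have : (fine D)%:E = D by rewrite fineK.
move: (fine D) => z zE; rewrite -zE !lee_fin in D0 D1.
rewrite /cascade_phi EXs.
have [z0|z0] := leP z 0.
  (* Here [X^0 = 1], so [phi(0) = 0]. *)
  have -> : z = 0 by apply/eqP; rewrite eq_le z0 D0.
  under eq_integral do rewrite powRr0.
  have -> : (\int[P]_om 1%:E = 1%:E)%E.
    by rewrite integral_cst// mul1e; exact: probability_setT.
  by rewrite /= /log2 ln1 mul0r subee// hdim_ge0.
have [Ez mz0] := moment_bounds mX EX (introT andP (conj z0 D1)).
rewrite Ez /= -EFinB leNgt; apply/negP.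
(* Supposing [zeta_0 < phi(zeta) = f], some [t < f] has vanishing Euclidean measure. *)
set f := z - _ => /ereal_inf_lt[_ [t [t0 Ht] <-]]; rewrite lte_fin => tf.
have f0 : 0 < f by exact: lt_trans tf.
have ln2 : 0 < ln 2 :> R by rewrite ln_gt0// ltr1n.
have pf : 2 `^ (- z) * moment P X z = 2 `^ (- f).
  rewrite -[X in _ * X]lnK ?posrE// /powR pnatr_eq0 /= -expRD; congr expR.
  by rewrite /f /log2; field; rewrite gt_eqF.
(* Above [z t / f], the exponent [s = q] satisfies [t <= (s / z) phi(z) <= phi(s)]; below [z], it
   contradicts the definition of the dimension. *)
have [q] : exists q : rat, ratr q \in `](z * (t / f)), z[.
  apply: rat_in_itvoo.
  by rewrite gtr_pMr// ltr_pdivrMr// mul1r.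
rewrite in_itv/= => /andP[qlt qz].
set s : R := ratr q in qlt qz.
have s0 : 0 < s by rewrite (le_lt_trans _ qlt)// mulr_ge0// divr_ge0// ltW.
have s1 : s <= 1 by rewrite (le_trans (ltW qz)).
have : (D <= s%:E)%E.
  apply: hdim_le => //; apply: (small q t) => //; first by rewrite s0 s1.
  apply: (@le_trans _ _ (2 `^ (- s) * moment P X z `^ (s / z))).
    by rewrite ler_wpM2l ?powR_ge0// (moment_le mX EX)// ltW.
  have -> : 2 `^ (- s) = (2 `^ (- z)) `^ (s / z) :> R.
    by rewrite -powRrM; congr (_ `^ _); field; rewrite gt_eqF.
  rewrite -powRM; [|exact: powR_ge0|exact: ltW].
  rewrite pf -powRrM.
  apply: ler_powR; first by rewrite ler1n.
  rewrite mulNr lerN2 mulrA ler_pdivlMr//.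
  by move: qlt; rewrite mulrA ltr_pdivrMr// => /ltW; rewrite mulrC [s * f]mulrC.
by rewrite -zE lee_fin leNgt qz.
Qed.
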